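(* Let $0\le\lambda\le1$, $0\le\alpha<1$, $t\in(0,1)$, let $f(z)=z+\sum_{n=2}^\infty a_nz^n$ be in the class $\mathcal{R}_\Sigma(\lambda,\alpha,\Phi(z,t))$, and let $\mu\in\mathbb{R}$. Put $$M=\frac{\left|\frac{(1+\lambda)^2\Psi_2^2(\alpha)}{4t^2}+2(1+2\lambda)\Psi_3(\alpha)-(\lambda^2+5\lambda+2)\Psi_2^2(\alpha)\right|}{2(1+2\lambda)\Psi_3(\alpha)}.$$ If $|\mu-1|\le M$, then $$|a_3-\mu a_2^2|\le\frac{t}{(1+2\lambda)\Psi_3(\alpha)}.$$ If $|\mu-1|\ge M$ and $\left(2(1+2\lambda)\Psi_3(\alpha)-(\lambda^2+5\lambda+2)\Psi_2^2(\alpha)\right)4t^2+(1+\lambda)^2\Psi_2^2(\alpha)\neq0$, then $$|a_3-\mu a_2^2|\le\frac{8|1-\mu|t^3}{\left|\left(2(1+2\lambda)\Psi_3(\alpha)-(\lambda^2+5\lambda+2)\Psi_2^2(\alpha)\right)4t^2+(1+\lambda)^2\Psi_2^2(\alpha)\right|}.$$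
   Context: Let $\triangle=\{z\in\mathbb{C}:|z|<1\}$. Let $\mathcal{A}$ be the class of analytic functions on $\triangle$ of the form $f(z)=z+\sum_{n\ge2}a_nz^n$. A function $f\in\mathcal{A}$ is bi-univalent if both $f$ and $f^{-1}$ are univalent in $\triangle$ (i.e. $f$ is univalent in $\triangle$ and the inverse $f^{-1}$, defined near $0$, extends to a univalent analytic function on $\triangle$); $\Sigma$ is the class of bi-univalent functions. For $f\in\Sigma$ write $g=f^{-1}$, so $g(w)=w-a_2w^2+(2a_2^2-a_3)w^3+\cdots$. For analytic $p,q$ on $\triangle$, $p\prec q$ ($p$ is subordinate to $q$) means there is an analytic $\omega$ on $\triangle$ with $\omega(0)=0$, $|\omega(z)|<1$ and $p(z)=q(\omega(z))$. For $0\le\alpha<1$ let $s(z)=\dfrac{z}{(1-z)^{2(1-\alpha)}}=z+\sum_{n\ge2}\Psi_n(\alpha)z^n$, where $\Psi_n(\alpha)=\dfrac{\prod_{k=2}^n(k-2\alpha)}{(n-1)!}$; thus $\Psi_2(\alpha)=2-2\alpha$ and $\Psi_3(\alpha)=\frac{(2-2\alpha)(3-2\alpha)}{2}$. $\Psi_n^2(\alpha)$ means $(\Psi_n(\alpha))^2$. Let $*$ denote the Hadamard (coefficientwise) product of power series, and put $F=s*f$, $G=s*g$, so $F(z)=z+\Psi_2(\alpha)a_2z^2+\Psi_3(\alpha)a_3z^3+\cdots$ and $G(w)=w-\Psi_2(\alpha)a_2w^2+\Psi_3(\alpha)(2a_2^2-a_3)w^3+\cdots$. Let $\Phi(z,t)=\dfrac{1}{1-2tz+z^2}$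 for $z\in\triangle$. For $0\le\lambda\le1$, $0\le\alpha<1$ and $t\in(0,1)$, the class $\mathcal{R}_\Sigma(\lambda,\alpha,\Phi(z,t))$ consists of all $f\in\Sigma$ such that, for $z,w\in\triangle$, $$(1-\lambda)\frac{zF'(z)}{F(z)}+\lambda\left(1+\frac{zF''(z)}{F'(z)}\right)\prec\Phi(z,t)\quad\text{and}\quad(1-\lambda)\frac{wG'(w)}{G(w)}+\lambda\left(1+\frac{wG''(w)}{G'(w)}\right)\prec\Phi(w,t).$$ *)

(* Defs.v *)
From Stdlib Require Import Reals List Factorial.
From Coquelicot Require Import Coquelicot.

Open Scope R_scope.

Definition in_disc (z : C) : Prop := Cmod z < 1.

(* Functions on the unit disc are represented by total functions on [C]; their
   values outside the disc are never used. *)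

Definition analytic_on_disc (f : C -> C) : Prop :=
  forall z0 : C, in_disc z0 ->
  exists (c : nat -> C) (r : R), 0 < r /\
    forall z : C, Cmod (z - z0)%C < r ->
      @is_pseries C_AbsRing C_NormedModule c (z - z0)%C (f z).

Definition power_series_on_disc (a : nat -> C) (f : C -> C) : Prop :=
  forall z : C, in_disc z -> @is_pseries C_AbsRing C_NormedModule a z (f z).

Definition normalized_series (a : nat -> C) (f : C -> C) : Prop :=
  a 0%nat = RtoC 0 /\ a 1%nat = RtoC 1 /\ power_series_on_disc a f.

Definition class_A (f : C -> C) : Prop :=
  analytic_on_disc f /\ exists a : nat -> C, normalized_series a f.

Definition univalent (f : C -> C) : Prop :=
  analytic_on_disc f /\
  forall z1 z2 : C, in_disc z1 -> in_disc z2 -> f z1 = f z2 -> z1 = z2.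

(* [g] is a univalent extension to the disc of the germ at 0 of the inverse of
   the restriction of [f] to the disc. *)
Definition univalent_inverse (f g : C -> C) : Prop :=
  univalent g /\
  exists rho : R, 0 < rho /\
    forall w : C, Cmod w < rho -> in_disc (g w) /\ f (g w) = w.

Definition class_Sigma (f : C -> C) : Prop :=
  class_A f /\ univalent f /\ exists g : C -> C, univalent_inverse f g.

Definition subordinate (p q : C -> C) : Prop :=
  analytic_on_disc p /\ analytic_on_disc q /\
  exists omega : C -> C,
    analytic_on_disc omega /\ omega (RtoC 0) = RtoC 0 /\
    forall z : C, in_disc z -> Cmod (omega z) < 1 /\ p z = q (omega z).

Definition hadamard_product (f1 f2 h : C -> C) : Prop :=
  exists a b : nat -> C,
    power_series_on_disc a f1 /\ power_series_on_disc b f2 /\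
    power_series_on_disc (fun n => (a n * b n)%C) h.

(* Principal value of [w ^ c] on the half-plane [0 < Re w], where the principal
   argument of [w] is [atan (Im w / Re w)]. *)
Definition principal_power (w : C) (c : R) : C :=
  let theta := atan (Im w / Re w) in
  (RtoC (Rpower (Cmod w) c) * (cos (c * theta), sin (c * theta)))%C.

(* On the disc, [0 < Re (1 - z)]. *)
Definition s_fun (alpha : R) (z : C) : C :=
  (z / principal_power (RtoC 1 - z) (2 * (1 - alpha)))%C.

(* Taylor coefficients of [s_fun alpha], for [2 <= n]. *)
Definition Psi (n : nat) (alpha : R) : R :=
  fold_right Rmult 1 (map (fun k => INR k - 2 * alpha) (seq 2 (n - 1)))
  / INR (fact (n - 1)).

Definition Phi (t : R) (z : C) : C :=
  (RtoC 1 / (RtoC 1 - RtoC (2 * t) * z + z * z))%C.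

(* [C_derive] is a limit along horizontal increments; it is the complex
   derivative here because [F] is the sum of a power series on the disc. *)
Definition convex_combination (lambda : R) (F : C -> C) (z : C) : C :=
  (RtoC (1 - lambda) * (z * C_derive F z / F z) +
   RtoC lambda *
     (RtoC 1 + z * C_derive (C_derive F) z / C_derive F z))%C.

(* At [z = 0] the quotient [z F'(z) / F(z)] is [0 / 0], so the subordinate
   function is the analytic extension [p] of the expression across that
   removable singularity.  At any other point of the disc a genuine pole of the
   expression is excluded by the analyticity of [p]. *)
Definition subordination_condition (lambda t : R) (F : C -> C) : Prop :=
  exists p : C -> C,
    (forall z : C, in_disc z -> z <> RtoC 0 ->
       p z = convex_combination lambda F z) /\
    subordinate p (Phi t).

Definition class_R_Sigma (lambda alpha t : R) (f : C -> C) : Prop :=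
  class_Sigma f /\
  exists g F G : C -> C,
    univalent_inverse f g /\
    hadamard_product (s_fun alpha) f F /\
    hadamard_product (s_fun alpha) g G /\
    subordination_condition lambda t F /\
    subordination_condition lambda t G.

(* Main.v *)
Require Import Defs.
From Stdlib Require Import Reals Lra List Classical ClassicalEpsilon.
From Coquelicot Require Import Coquelicot.

(** Write [S2], [S3] for [Psi 2 alpha], [Psi 3 alpha], and let [w1, w2] and
    [v1, v2] be the first two Taylor coefficients of the Schwarz functions of
    the two subordinations.  Since Phi(z,t) = 1 + 2t z + (4t^2-1) z^2 + ...,
    comparing coefficients for [F] gives
      (1+lambda) S2 a2 = 2t w1,
      2(1+2lambda) S3 a3 - (1+3lambda) S2^2 a2^2 = 2t w2 + (4t^2-1) w1^2,
    and the same equations hold for [G], with [-a2], [2 a2^2 - a3], [v1], [v2]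
    in place of [a2], [a3], [w1], [w2].  The first equations force v1 = - w1.
    The sum and the difference of the second equations are then
      D a2^2 = 4t^3 (w2 + v2),   a3 - a2^2 = t/(2K) (w2 - v2),
    with K = (1+2lambda) S3, so that for D <> 0, with h = 4t^3 (1-mu)/D,
      a3 - mu a2^2 = (h + t/(2K)) w2 + (h - t/(2K)) v2.
    As |w2| <= 1 and |v2| <= 1, the modulus is at most 2 max(|h|, t/(2K)), and
    the two cases of the theorem say which of the two terms is the larger.
    When D = 0 the first case forces mu = 1, and the formula for a3 - a2^2
    suffices.  This elimination is [fekete_szego_of_coefficient_equations].

    The analytic inputs need only expansions to second order,
    f(z0+h) = c0 + c1 h + c2 h^2 + O(h^3), which are recorded by [jet].
    They are closed under sums, products and composition, and their coefficients
    are determined by the values at small positive reals ([jet_unique]), so every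
    comparison of coefficients is an identity between jets.

    The bound |w2| <= 1 ([second_coefficient_bound]) is obtained by applying
    the maximum principle to the even part of the Schwarz function divided by
    z^2, whose value at 0 is w2.  A function with a jet at every point
    satisfies the maximum principle because |k|^2 + eps |z|^2 has, on average
    over the four points z0 + i^j rho, a value larger than at z0: the terms of
    order 1 and 2 cancel in the average, eps rho^2 remains, and it dominates the
    error O(rho^3).

    The jets of [F'] and [F''] come from termwise differentiation of power
    series ([sums_to_C_derive]).  The coefficients of [s_fun] are read off from
    its values on the positive reals ([s_fun_coefficients]), and those of the
    inverse function from f(g(w)) = w ([inverse_coefficients]). *)

Open Scope R_scope.

(** * Second-order expansions at a point *)

Definition near0 (P : C -> Prop) : Prop :=
  exists r : R, 0 < r /\ forall h : C, Cmod h < r -> P h.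

Definition bounded_near0 (E : C -> C) : Prop :=
  exists K : R, near0 (fun h => Cmod (E h) <= K).

Lemma near0_and (P Q : C -> Prop) :
  near0 P -> near0 Q -> near0 (fun h => P h /\ Q h).
Proof.
  intros [r [Hr HP]] [s [Hs HQ]].
  exists (Rmin r s); split; [now apply Rmin_pos|].
  intros h Hh.
  pose proof (Rmin_l r s); pose proof (Rmin_r r s).
  split; [apply HP | apply HQ]; lra.
Qed.

Lemma near0_mono (P Q : C -> Prop) :
  (forall h, P h -> Q h) -> near0 P -> near0 Q.
Proof. intros H [r [Hr HP]]; exists r; auto. Qed.

Lemma near0_all (P : C -> Prop) : (forall h, P h) -> near0 P.
Proof. intros H; exists 1; split; [lra | auto]. Qed.

Lemma near0_opp (P : C -> Prop) : near0 P -> near0 (fun h => P (- h)%C).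
Proof.
  intros [r [Hr HP]]; exists r; split; [assumption|].
  intros h Hh; apply HP; now rewrite Cmod_opp.
Qed.

Lemma bounded_near0_const (c : C) : bounded_near0 (fun _ => c).
Proof. exists (Cmod c); apply near0_all; intros; lra. Qed.

Lemma bounded_near0_id : bounded_near0 (fun h => h).
Proof. exists 1, 1; split; [lra | intros; lra]. Qed.

Lemma bounded_near0_plus (E F : C -> C) :
  bounded_near0 E -> bounded_near0 F -> bounded_near0 (fun h => E h + F h)%C.
Proof.
  intros [K HE] [L HF]; exists (K + L).
  generalize (near0_and _ _ HE HF); apply near0_mono; intros h [H1 H2].
  pose proof (Cmod_triangle (E h) (F h)); lra.
Qed.

Lemma bounded_near0_mult (E F : C -> C) :
  bounded_near0 E -> bounded_near0 F -> bounded_near0 (fun h => E h * F h)%C.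
Proof.
  intros [K HE] [L HF]; exists (K * L).
  generalize (near0_and _ _ HE HF); apply near0_mono; intros h [H1 H2].
  rewrite Cmod_mult.
  apply Rmult_le_compat; auto using Cmod_ge_0.
Qed.

Lemma bounded_near0_opp_arg (E : C -> C) :
  bounded_near0 E -> bounded_near0 (fun h => E (- h)%C).
Proof. intros [K HE]; exists K; now apply near0_opp in HE. Qed.

Create HintDb bnd.
#[local] Hint Resolve bounded_near0_const bounded_near0_id bounded_near0_plus
  bounded_near0_mult bounded_near0_opp_arg : bnd.

(** The error is kept as a function [E] with a bound, instead of an inequality
    [O(h^3)], so that the closure properties below are ring identities together
    with boundedness of an explicit expression in the errors. *)
Definition jet (f : C -> C) (z0 c0 c1 c2 : C) : Prop :=
  exists E : C -> C, bounded_near0 E /\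
    near0 (fun h => f (z0 + h)%C = (c0 + c1 * h + c2 * (h * h) + h * h * h * E h)%C).

Lemma jet_value (f : C -> C) (z0 c0 c1 c2 : C) : jet f z0 c0 c1 c2 -> f z0 = c0.
Proof.
  intros [E [_ [r [Hr H]]]].
  specialize (H 0%C); rewrite Cmod_0 in H; specialize (H Hr).
  replace (z0 + 0)%C with z0 in H by ring.
  rewrite H; ring.
Qed.

Lemma jet_ext (f g : C -> C) (z0 c0 c1 c2 : C) :
  near0 (fun h => f (z0 + h)%C = g (z0 + h)%C) ->
  jet f z0 c0 c1 c2 -> jet g z0 c0 c1 c2.
Proof.
  intros Hfg [E [HE H]]; exists E; split; [assumption|].
  generalize (near0_and _ _ Hfg H); apply near0_mono.
  intros h [H1 H2]; now rewrite <- H1.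
Qed.

Lemma jet_const (c z0 : C) : jet (fun _ => c) z0 c 0 0.
Proof.
  exists (fun _ => RtoC 0); split; [auto with bnd|].
  apply near0_all; intros h; ring.
Qed.

Lemma jet_id (z0 : C) : jet (fun z => z) z0 z0 1 0.
Proof.
  exists (fun _ => RtoC 0); split; [auto with bnd|].
  apply near0_all; intros h; ring.
Qed.

Lemma jet_plus (f g : C -> C) (z0 c0 c1 c2 d0 d1 d2 : C) :
  jet f z0 c0 c1 c2 -> jet g z0 d0 d1 d2 ->
  jet (fun z => f z + g z)%C z0 (c0 + d0) (c1 + d1) (c2 + d2).
Proof.
  intros [E [HE Hf]] [F [HF Hg]].
  exists (fun h => E h + F h)%C; split; [auto with bnd|].
  generalize (near0_and _ _ Hf Hg); apply near0_mono.
  intros h [H1 H2]; rewrite H1, H2; ring.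
Qed.

Lemma jet_mult (f g : C -> C) (z0 c0 c1 c2 d0 d1 d2 : C) :
  jet f z0 c0 c1 c2 -> jet g z0 d0 d1 d2 ->
  jet (fun z => f z * g z)%C z0
    (c0 * d0) (c0 * d1 + c1 * d0) (c0 * d2 + c1 * d1 + c2 * d0).
Proof.
  intros [E [HE Hf]] [F [HF Hg]].
  exists (fun h => c1 * d2 + c2 * d1 + h * (c2 * d2)
    + E h * (d0 + d1 * h + d2 * (h * h))
    + F h * (c0 + c1 * h + c2 * (h * h))
    + h * (h * h) * (E h * F h))%C; split; [auto 20 with bnd|].
  generalize (near0_and _ _ Hf Hg); apply near0_mono.
  intros h [H1 H2]; rewrite H1, H2; ring.
Qed.

(** Needed for the even part of a Schwarz function. *)
Lemma jet_opp_arg (f : C -> C) (z0 c0 c1 c2 : C) :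
  jet f (- z0)%C c0 c1 c2 -> jet (fun z => f (- z)%C) z0 c0 (- c1) c2.
Proof.
  intros [E [HE Hf]].
  exists (fun h => - (1) * E (- h))%C; split; [auto with bnd|].
  apply near0_opp in Hf; revert Hf; apply near0_mono; intros h H.
  replace (- (z0 + h))%C with (- z0 + - h)%C by ring.
  rewrite H; ring.
Qed.

Lemma jet_comp (f g : C -> C) (z0 c0 c1 c2 d0 d1 d2 : C) :
  jet g z0 d0 d1 d2 -> jet f d0 c0 c1 c2 ->
  jet (fun z => f (g z)) z0 c0 (c1 * d1) (c1 * d2 + c2 * (d1 * d1)).
Proof.
  intros [F [HF Hg]] [E [HE Hf]].
  (* The inner function is [d0 + h * m h] with [m] bounded, so [h * m h] stays in
     any given neighbourhood of 0 as [h] tends to 0. *)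
  pose (m := fun h => (d1 + d2 * h + h * h * F h)%C).
  assert (Hm : bounded_near0 m) by (unfold m; auto 20 with bnd).
  assert (Hsub : forall P, near0 P -> near0 (fun h => P (h * m h)%C)).
  { intros P [r [Hr HP]].
    destruct Hm as [K [s [Hs HK]]].
    assert (HK1 : 0 <= K).
    { apply Rle_trans with (2 := HK 0%C ltac:(now rewrite Cmod_0)), Cmod_ge_0. }
    exists (Rmin s (r / (K + 1))); split.
    { apply Rmin_pos; [assumption | apply Rdiv_lt_0_compat; lra]. }
    intros h Hh; apply HP.
    pose proof (Rmin_l s (r / (K + 1))); pose proof (Rmin_r s (r / (K + 1))).
    rewrite Cmod_mult.
    apply Rle_lt_trans with (Cmod h * (K + 1)).
    { apply Rmult_le_compat_l; [apply Cmod_ge_0 |].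
      pose proof (HK h ltac:(lra)); lra. }
    replace r with (r / (K + 1) * (K + 1)) by (field; lra).
    apply Rmult_lt_compat_r; lra. }
  assert (HEm : bounded_near0 (fun h => E (h * m h)%C)).
  { destruct HE as [K HK]; exists K; now apply Hsub in HK. }
  exists (fun h => c1 * F h
    + c2 * (m h * (d2 + h * F h) + d1 * (d2 + h * F h))
    + m h * m h * m h * E (h * m h))%C; split; [auto 20 with bnd|].
  apply Hsub in Hf.
  generalize (near0_and _ _ Hf Hg); apply near0_mono; intros h [H1 H2].
  rewrite H2.
  replace (d0 + d1 * h + d2 * (h * h) + h * h * h * F h)%C
    with (d0 + h * m h)%C by (unfold m; ring).
  rewrite H1; generalize (E (h * m h)%C); intros e; unfold m; ring.
Qed.

Lemma jet_inv_id (z0 : C) :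
  z0 <> 0%C -> exists c0 c1 c2, jet (fun z => / z)%C z0 c0 c1 c2.
Proof.
  intros Hz0.
  exists (/ z0)%C, (- / (z0 * z0))%C, (/ (z0 * z0 * z0))%C.
  apply Cmod_gt_0 in Hz0 as Hp.
  assert (Hh : near0 (fun h => Cmod z0 / 2 <= Cmod (z0 + h))).
  { exists (Cmod z0 / 2); split; [lra|]; intros h Hh.
    pose proof (Cmod_triangle (z0 + h) (- h)) as H.
    replace (z0 + h + - h)%C with z0 in H by ring.
    rewrite Cmod_opp in H; lra. }
  exists (fun h => - / (z0 * z0 * z0) * / (z0 + h))%C; split.
  - apply bounded_near0_mult; [auto with bnd|].
    exists (/ (Cmod z0 / 2)); revert Hh; apply near0_mono; intros h Hh.
    rewrite Cmod_inv by (apply Cmod_gt_0; lra).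
    apply Rinv_le_contravar; lra.
  - revert Hh; apply near0_mono; intros h Hh.
    assert ((z0 + h)%C <> 0%C) by (apply Cmod_gt_0; lra).
    field; now split.
Qed.

Lemma jet_neq0 (f : C -> C) (z0 c0 c1 c2 : C) :
  jet f z0 c0 c1 c2 -> c0 <> 0%C -> near0 (fun h => f (z0 + h)%C <> 0%C).
Proof.
  intros [E [HE Hf]] Hc0; apply Cmod_gt_0 in Hc0.
  assert (HB : bounded_near0 (fun h => c1 + c2 * h + h * h * E h)%C)
    by auto 20 with bnd.
  destruct HB as [K HK].
  assert (Hs : near0 (fun h => Cmod h * (Rabs K + 1) < Cmod c0)).
  { pose proof (Rabs_pos K).
    exists (Cmod c0 / (Rabs K + 1)); split; [apply Rdiv_lt_0_compat; lra|].
    intros h Hh.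
    replace (Cmod c0) with (Cmod c0 / (Rabs K + 1) * (Rabs K + 1)) by (field; lra).
    apply Rmult_lt_compat_r; lra. }
  generalize (near0_and _ _ Hs (near0_and _ _ HK Hf)); apply near0_mono.
  intros h (H1 & H2 & H3) H0.
  rewrite H0 in H3.
  assert (Hc : c0 = (- (h * (c1 + c2 * h + h * h * E h)))%C).
  { replace c0 with (c0 - 0)%C by ring. rewrite H3; ring. }
  rewrite Hc, Cmod_opp, Cmod_mult in H1.
  apply (Rlt_irrefl (Cmod h * (Rabs K + 1))).
  apply Rlt_le_trans with (1 := H1), Rmult_le_compat_l; [apply Cmod_ge_0|].
  pose proof (Rle_abs K); lra.
Qed.

Lemma constant_term_zero (c : C) (E : C -> C) :
  bounded_near0 E ->
  (exists r, 0 < r /\ forall x : R, 0 < x < r -> (c + x * E x)%C = 0%C) -> c = 0%C.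
Proof.
  intros [K [r [Hr HK]]] [s [Hs H]].
  destruct (Ceq_dec c 0) as [Hc|Hc]; [assumption | exfalso].
  apply Cmod_gt_0 in Hc.
  pose proof (Rabs_pos K) as HKp.
  pose (x := Rmin (Rmin r s) (Cmod c / (Rabs K + 1)) / 2).
  assert (Hm : 0 < Rmin (Rmin r s) (Cmod c / (Rabs K + 1))).
  { repeat apply Rmin_pos; auto; apply Rdiv_lt_0_compat; lra. }
  pose proof (Rmin_l (Rmin r s) (Cmod c / (Rabs K + 1))).
  pose proof (Rmin_r (Rmin r s) (Cmod c / (Rabs K + 1))) as Hx3.
  pose proof (Rmin_l r s); pose proof (Rmin_r r s).
  assert (Hx : 0 < x) by (unfold x; lra).
  specialize (H x ltac:(unfold x in *; lra)).
  assert (HKx : Cmod (E x) <= K).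
  { apply HK; rewrite Cmod_R, Rabs_pos_eq; unfold x in *; lra. }
  assert (Hcx : c = (- (x * E x))%C).
  { replace c with (c + x * E x - x * E x)%C by ring. rewrite H; ring. }
  assert (Hle : Cmod c <= x * (Rabs K + 1)).
  { rewrite Hcx, Cmod_opp, Cmod_mult, Cmod_R, (Rabs_pos_eq x) by lra.
    apply Rmult_le_compat_l; [lra|].
    pose proof (Rle_abs K); lra. }
  assert (Hlt : x * (Rabs K + 1) < Cmod c / (Rabs K + 1) * (Rabs K + 1)).
  { apply Rmult_lt_compat_r; unfold x in *; lra. }
  replace (Cmod c / (Rabs K + 1) * (Rabs K + 1)) with (Cmod c) in Hlt by (field; lra).
  lra.
Qed.

(** Positive reals suffice: a relation [c + x * E x = 0] with [E] bounded gives
    [c = 0] on letting [x] tend to 0, and this is used once for each order.  The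
    weak hypothesis matters because [s_fun] is easy to expand only on the reals,
    and because quotients such as [F z / z] are only known away from 0. *)
Lemma jet_unique (f g : C -> C) (z0 c0 c1 c2 d0 d1 d2 : C) :
  jet f z0 c0 c1 c2 -> jet g z0 d0 d1 d2 ->
  (exists r, 0 < r /\ forall x : R, 0 < x < r -> f (z0 + x)%C = g (z0 + x)%C) ->
  c0 = d0 /\ c1 = d1 /\ c2 = d2.
Proof.
  intros [E [HE Hf]] [F [HF Hg]] [r [Hr Hfg]].
  destruct (near0_and _ _ Hf Hg) as [s [Hs Hfg']].
  assert (Hmin : 0 < Rmin r s) by now apply Rmin_pos.
  pose proof (Rmin_l r s); pose proof (Rmin_r r s).
  assert (H1 : forall x : R, 0 < x < Rmin r s ->
    ((c0 - d0) + x * ((c1 - d1) + x * ((c2 - d2) + x * (E x - F x))) = 0)%C).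
  { intros x Hx.
    specialize (Hfg x ltac:(lra)).
    destruct (Hfg' x) as [H2 H3].
    { rewrite Cmod_R, Rabs_pos_eq; lra. }
    rewrite H2, H3 in Hfg.
    match type of Hfg with ?a = ?b =>
      transitivity (a - b)%C; [ring | rewrite Hfg; ring] end. }
  assert (Hsub : bounded_near0 (fun h => E h - F h)%C).
  { destruct (bounded_near0_plus E (fun h => - (1) * F h)%C) as [K HK];
      [auto with bnd .. |].
    exists K; revert HK; apply near0_mono; intros h.
    replace (E h + - (1) * F h)%C with (E h - F h)%C;
      [easy | ring]. }
  assert (Hcancel : forall (x : R) (w : C), 0 < x -> (0 + x * w = 0 -> w = 0)%C).
  { intros x w Hx Hw.
    assert (RtoC x <> 0)%C by (apply Cmod_gt_0; rewrite Cmod_R, Rabs_pos_eq; lra).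
    replace w with ((0 + x * w) / x)%C by (field; assumption).
    rewrite Hw; field; assumption. }
  assert (E0 : (c0 - d0)%C = 0%C).
  { apply constant_term_zero with
      (E := fun h => ((c1 - d1) + h * ((c2 - d2) + h * (E h - F h)))%C);
      [auto 20 with bnd | eauto]. }
  rewrite E0 in H1.
  assert (E1 : (c1 - d1)%C = 0%C).
  { apply constant_term_zero with (E := fun h => ((c2 - d2) + h * (E h - F h))%C);
      [auto 20 with bnd | exists (Rmin r s); split; [assumption|]].
    intros x Hx; apply (Hcancel x); [lra | auto]. }
  rewrite E1 in H1.
  assert (E2 : (c2 - d2)%C = 0%C).
  { apply constant_term_zero with (E := fun h => (E h - F h)%C);
      [auto 20 with bnd | exists (Rmin r s); split; [assumption|]].
    intros x Hx; apply (Hcancel x); [lra|]; apply (Hcancel x); [lra | auto]. }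
  assert (Hsubeq : forall a b : C, (a - b)%C = 0%C -> a = b).
  { intros a b Hab; replace a with (a - b + b)%C by ring; rewrite Hab; ring. }
  auto.
Qed.

(** * A maximum principle *)

Lemma finite_max {A : Type} (v : A -> R) (l : list A) :
  l <> nil -> exists m, In m l /\ forall y, In y l -> v y <= v m.
Proof.
  induction l as [|x l IH]; [congruence | intros _].
  destruct l as [|x' l].
  - exists x; split; [now left|]; intros y [<- | []]; lra.
  - destruct IH as [m [Hm Hmax]]; [congruence|].
    destruct (Rle_dec (v m) (v x)) as [Hle|Hlt].
    + exists x; split; [now left|]; intros y [<- | Hy]; [lra|].
      specialize (Hmax y Hy); lra.
    + exists m; split; [now right|]; intros y [<- | Hy]; [lra | auto].
Qed.

Lemma Cmod_le_components (z : C) : Cmod z <= Rabs (fst z) + Rabs (snd z).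
Proof.
  pose proof (Rabs_pos (fst z)); pose proof (Rabs_pos (snd z)).
  unfold Cmod; apply Rsqr_incr_0_var.
  2: lra.
  rewrite Rsqr_sqrt by nra.
  unfold Rsqr; rewrite <- (pow2_abs (fst z)), <- (pow2_abs (snd z)); nra.
Qed.

(** If no maximum existed, each point of the disc would have a neighbourhood on
    which [u] is smaller than some value [u z'].  Finitely many of these
    neighbourhoods cover the disc; the largest of the corresponding values would
    then be smaller than another of them. *)
Lemma usc_attains_max (u : C -> R) (r : R) :
  0 <= r ->
  (forall z c, Cmod z <= r -> u z < c ->
     exists d, 0 < d /\ forall y, Cmod (y - z)%C < d -> u y < c) ->
  exists m, Cmod m <= r /\ forall z, Cmod z <= r -> u z <= u m.
Proof.
  intros Hr Husc.
  apply NNPP; intros Hno.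
  assert (Hbetter : forall z : C, exists p : posreal * C,
    Cmod (snd p) <= r /\
    forall y, Cmod y <= r -> Cmod (y - z)%C < 2 * fst p -> u y < u (snd p)).
  { intros z.
    destruct (Rle_dec (Cmod z) r) as [Hz|Hz].
    - assert (Hz' : exists z', Cmod z' <= r /\ u z < u z').
      { apply NNPP; intros Hz'; apply Hno; exists z; split; [assumption|].
        intros y Hy; apply Rnot_lt_le; intros Hlt; apply Hz'; now exists y. }
      destruct Hz' as [z' [Hz' Hlt]].
      destruct (Husc z (u z') Hz Hlt) as [d [Hd Hdy]].
      assert (Hd2 : 0 < d / 2) by lra.
      exists (mkposreal _ Hd2, z'); split; [assumption|].
      simpl; intros y _ Hy; apply Hdy; lra.
    (* A point of the square outside the disc gets a neighbourhood missing the disc. *)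
    - assert (Hd : 0 < (Cmod z - r) / 2) by lra.
      exists (mkposreal _ Hd, RtoC 0); split; [cbn [snd]; now rewrite Cmod_0|].
      simpl; intros y Hy Hyz; exfalso.
      pose proof (Cmod_triangle y (- (y - z))) as H.
      replace (y + - (y - z))%C with z in H by ring.
      rewrite Cmod_opp in H; lra. }
  pose (p := fun z => proj1_sig (constructive_indefinite_description _ (Hbetter z))).
  pose proof (fun z => proj2_sig (constructive_indefinite_description _ (Hbetter z))) as Hp.
  change (forall z : C, Cmod (snd (p z)) <= r /\
    forall y, Cmod y <= r -> Cmod (y - z)%C < 2 * fst (p z) -> u y < u (snd (p z))) in Hp.
  clearbody p.
  apply (compactness_list 2 (- r, (- r, tt)) (r, (r, tt))
           (fun x => fst (p (fst x, fst (snd x))))).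
  intros [l Hl].
  assert (Hcover : forall y, Cmod y <= r ->
    exists x, In x l /\ u y < u (snd (p (fst x, fst (snd x))))).
  { intros y Hy.
    pose proof (Rmax_Cmod y) as Hmax.
    pose proof (Rmax_l (Rabs (fst y)) (Rabs (snd y))).
    pose proof (Rmax_r (Rabs (fst y)) (Rabs (snd y))).
    destruct (Hl (fst y, (snd y, tt))) as [[x1 [x2 []]] (Hin & _ & Hclose)].
    { simpl; split; [|split; [|exact I]]; apply Rabs_le_between; lra. }
    exists (x1, (x2, tt)); split; [assumption|].
    destruct (Hp (x1, x2)) as [_ Hpx]; apply Hpx; [assumption|].
    simpl in Hclose.
    apply Rle_lt_trans with (1 := Cmod_le_components _).
    destruct y as [y1 y2]; simpl in *; unfold Rminus in Hclose; lra. }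
  destruct (Hcover (RtoC 0)) as [x0 [Hx0 _]]; [now rewrite Cmod_0|].
  destruct (finite_max (fun x => u (snd (p (fst x, fst (snd x))))) l)
    as [m [Hm Hmax]]; [now destruct l|].
  destruct (Hcover (snd (p (fst m, fst (snd m))))) as [x [Hx Hlt]]; [apply Hp|].
  specialize (Hmax x Hx); simpl in Hmax; lra.
Qed.

Definition Cmod2 (z : C) : R := fst z * fst z + snd z * snd z.

Lemma Cmod2_sqr (z : C) : Cmod2 z = Cmod z * Cmod z.
Proof.
  unfold Cmod2, Cmod; rewrite sqrt_sqrt; [ring | nra].
Qed.

Lemma Cmod2_perturbation (a b : C) :
  Cmod2 (a + b)%C <= Cmod2 a + Cmod b * (2 * Cmod a + Cmod b).
Proof.
  rewrite !Cmod2_sqr.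
  pose proof (Cmod_triangle a b); pose proof (Cmod_ge_0 a);
  pose proof (Cmod_ge_0 b); pose proof (Cmod_ge_0 (a + b)%C).
  nra.
Qed.

Lemma jet_Cmod2_perturbation (f : C -> C) (z0 c0 c1 c2 : C) :
  jet f z0 c0 c1 c2 ->
  exists B, 0 <= B /\ near0 (fun h => Cmod2 (f (z0 + h)%C) <= Cmod2 (f z0) + B * Cmod h).
Proof.
  intros Hj; rewrite (jet_value _ _ _ _ _ Hj).
  destruct Hj as [E [HE Hf]].
  assert (HB : bounded_near0 (fun h => c1 + c2 * h + h * h * E h)%C)
    by auto 20 with bnd.
  destruct HB as [K HK].
  pose proof (Rabs_pos K); pose proof (Rle_abs K); pose proof (Cmod_ge_0 c0).
  exists (Rabs K * (2 * Cmod c0 + Rabs K)); split; [nra|].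
  assert (Hone : near0 (fun h => Cmod h < 1)) by (exists 1; split; [lra | auto]).
  generalize (near0_and _ _ Hone (near0_and _ _ HK Hf)); apply near0_mono.
  intros h (Hh1 & Hh2 & ->).
  replace (c0 + c1 * h + c2 * (h * h) + h * h * h * E h)%C
    with (c0 + h * (c1 + c2 * h + h * h * E h))%C by ring.
  apply Rle_trans with (1 := Cmod2_perturbation _ _).
  rewrite Cmod_mult.
  set (q := Cmod (c1 + c2 * h + h * h * E h)%C) in *.
  assert (0 <= q) by apply Cmod_ge_0.
  pose proof (Cmod_ge_0 h).
  assert (q * (2 * Cmod c0 + Cmod h * q) <= Rabs K * (2 * Cmod c0 + Rabs K)).
  { apply Rmult_le_compat; nra. }
  nra.
Qed.

(** Over the points [h = rho, -rho, i rho, -i rho] the sums of [h] and of [h^2]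
    vanish and [|z0+h|^2] averages to [|z0|^2 + rho^2].  The square modulus of
    [c0 + v] is at least [|c0|^2 + 2 Re (conj c0 * v)], so the average of
    [|k|^2 + eps |z|^2] exceeds its value at [z0] by at least
    [eps rho^2 - 2 |c0| K rho^3]. *)
Lemma jet_no_local_max (k : C -> C) (z0 c0 c1 c2 : C) (eps : R) :
  0 < eps -> jet k z0 c0 c1 c2 ->
  ~ near0 (fun h => Cmod2 (k (z0 + h)%C) + eps * Cmod2 (z0 + h)%C
                    <= Cmod2 (k z0) + eps * Cmod2 z0).
Proof.
  intros Heps Hj Hmax.
  rewrite (jet_value _ _ _ _ _ Hj) in Hmax.
  destruct Hj as [E [[K HK] Hf]].
  destruct (near0_and _ _ Hmax (near0_and _ _ HK Hf)) as [r [Hr H]].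
  clear Hmax HK Hf.
  pose proof (Rabs_pos K); pose proof (Rle_abs K); pose proof (Cmod_ge_0 c0).
  (* So small that [2 |c0| |K| rho < eps]. *)
  pose (rho := Rmin (r / 2) (eps / (4 * (Cmod c0 * Rabs K + 1)))).
  assert (Hd : 0 < Cmod c0 * Rabs K + 1) by nra.
  assert (Hrho : 0 < rho).
  { apply Rmin_pos; [lra|]; apply Rdiv_lt_0_compat; lra. }
  pose proof (Rmin_l (r / 2) (eps / (4 * (Cmod c0 * Rabs K + 1)))) as Hr1.
  pose proof (Rmin_r (r / 2) (eps / (4 * (Cmod c0 * Rabs K + 1)))) as Hr2.
  fold rho in Hr1, Hr2.
  assert (Hstep : forall h : C, Cmod h = rho -> exists e : C, Cmod e <= rho * rho * rho * Rabs K /\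
    2 * (fst c0 * fst (c1 * h + c2 * (h * h) + e)%C
       + snd c0 * snd (c1 * h + c2 * (h * h) + e)%C)
    + eps * (Cmod2 (z0 + h)%C - Cmod2 z0) <= 0).
  { intros h Hh.
    destruct (H h) as (Hmx & HEh & Hkh); [lra|].
    exists (h * h * h * E h)%C; split.
    { rewrite !Cmod_mult, Hh.
      apply Rmult_le_compat_l; [|lra].
      repeat apply Rmult_le_pos; lra. }
    rewrite Hkh in Hmx.
    replace (c0 + c1 * h + c2 * (h * h) + h * h * h * E h)%C
      with (c0 + (c1 * h + c2 * (h * h) + h * h * h * E h))%C in Hmx by ring.
    set (v := (c1 * h + c2 * (h * h) + h * h * h * E h)%C) in *.
    replace (Cmod2 (c0 + v)%C) with
      (Cmod2 c0 + 2 * (fst c0 * fst v + snd c0 * snd v) + Cmod2 v) in Hmx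
      by (unfold Cmod2; simpl; ring).
    assert (0 <= Cmod2 v) by (unfold Cmod2; nra).
    lra. }
  assert (Habs : forall x : R, Cmod (x, 0) = Rabs x) by (intros; apply Cmod_R).
  assert (Habs' : forall x : R, Cmod (0, x) = Rabs x).
  { intros x; unfold Cmod; simpl.
    replace (0 * (0 * 1) + x * (x * 1)) with (Rsqr x) by (unfold Rsqr; ring).
    apply sqrt_Rsqr_abs. }
  destruct (Hstep (rho, 0)) as [e1 [He1 Hs1]]; [rewrite Habs; apply Rabs_pos_eq; lra|].
  destruct (Hstep (- rho, 0)) as [e2 [He2 Hs2]]; [rewrite Habs, Rabs_Ropp; apply Rabs_pos_eq; lra|].
  destruct (Hstep (0, rho)) as [e3 [He3 Hs3]]; [rewrite Habs'; apply Rabs_pos_eq; lra|].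
  destruct (Hstep (0, - rho)) as [e4 [He4 Hs4]]; [rewrite Habs', Rabs_Ropp; apply Rabs_pos_eq; lra|].
  assert (Hcs : forall e, - (Cmod c0 * Cmod e) <= fst c0 * fst e + snd c0 * snd e).
  { intros e.
    assert (Hconj : fst c0 * fst e + snd c0 * snd e = Re (Cconj c0 * e)%C)
      by (simpl; ring).
    rewrite Hconj, <- (Cmod_conj c0), <- Cmod_mult.
    pose proof (re_le_Cmod (Cconj c0 * e)%C) as Hre.
    apply Rabs_le_between in Hre; lra. }
  assert (Hlow : forall e, Cmod e <= rho * rho * rho * Rabs K ->
     - (Cmod c0 * (rho * rho * rho * Rabs K)) <= fst c0 * fst e + snd c0 * snd e).
  { intros e He; specialize (Hcs e); nra. }
  apply Hlow in He1, He2, He3, He4.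
  assert (Hsum : 4 * eps * (rho * rho) <= 8 * (Cmod c0 * (rho * rho * rho * Rabs K))).
  { unfold Cmod2 in *; simpl in *; nra. }
  assert (Hsum2 : eps <= 2 * (Cmod c0 * Rabs K) * rho).
  { apply Rmult_le_reg_l with (4 * (rho * rho)); [nra | nra]. }
  assert (Hfin : (4 * (Cmod c0 * Rabs K + 1)) * rho <= eps).
  { apply Rle_trans with (4 * (Cmod c0 * Rabs K + 1) * (eps / (4 * (Cmod c0 * Rabs K + 1)))).
    - apply Rmult_le_compat_l; lra.
    - right; field; lra. }
  nra.
Qed.

Definition has_jet (f : C -> C) (z : C) : Prop := exists c0 c1 c2, jet f z c0 c1 c2.

(** The term [eps |z|^2] pushes the maximum of [|k|^2 + eps |z|^2] to the
    boundary circle; then [eps] tends to 0. *)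
Lemma maximum_principle (k : C -> C) (r M : R) :
  0 < r -> 0 <= M ->
  (forall z, Cmod z <= r -> has_jet k z) ->
  (forall z, Cmod z = r -> Cmod (k z) <= M) ->
  Cmod (k 0%C) <= M.
Proof.
  intros Hr HM Hjet Hbd.
  assert (Heps : forall eps, 0 < eps -> Cmod2 (k 0%C) <= M * M + eps * (r * r)).
  { intros eps Heps.
    destruct (usc_attains_max (fun z => Cmod2 (k z) + eps * Cmod2 z) r)
      as [m [Hm Hmax]]; [lra | |].
    - intros z c Hz Hlt.
      destruct (Hjet z Hz) as (c0 & c1 & c2 & Hj).
      destruct (jet_Cmod2_perturbation _ _ _ _ _ Hj) as [B [HB0 HB]].
      destruct (jet_Cmod2_perturbation _ _ _ _ _ (jet_id z)) as [B' [HB0' HB']].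
      destruct (near0_and _ _ HB HB') as [s [Hs Hb]].
      set (g := c - (Cmod2 (k z) + eps * Cmod2 z)).
      assert (Hg : 0 < g) by (unfold g; lra).
      assert (HBB : 0 < B + eps * B' + 1) by nra.
      exists (Rmin s (g / (B + eps * B' + 1))); split.
      { apply Rmin_pos; [assumption | apply Rdiv_lt_0_compat; lra]. }
      intros y Hy.
      pose proof (Rmin_l s (g / (B + eps * B' + 1))).
      pose proof (Rmin_r s (g / (B + eps * B' + 1))).
      destruct (Hb (y - z)%C) as [H1 H2]; [lra|].
      replace (z + (y - z))%C with y in H1, H2 by ring.
      assert (H3 : Cmod (y - z)%C * (B + eps * B' + 1) < g).
      { replace g with (g / (B + eps * B' + 1) * (B + eps * B' + 1)) by (field; lra).
        apply Rmult_lt_compat_r; lra. }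
      pose proof (Cmod_ge_0 (y - z)%C).
      unfold g in H3; nra.
    - assert (Hk0 : Cmod2 (k 0%C) <= Cmod2 (k m) + eps * Cmod2 m).
      { specialize (Hmax 0%C); rewrite Cmod_0 in Hmax; specialize (Hmax ltac:(lra)).
        unfold Cmod2 at 2 in Hmax; simpl in Hmax; lra. }
      apply Rle_lt_or_eq_dec in Hm; destruct Hm as [Hm|Hm].
      + exfalso.
        destruct (Hjet m) as (c0 & c1 & c2 & Hj); [lra|].
        apply (jet_no_local_max _ _ _ _ _ eps Heps Hj).
        exists (r - Cmod m); split; [lra|]; intros h Hh.
        apply Hmax; pose proof (Cmod_triangle m h); lra.
      + specialize (Hbd m Hm); pose proof (Cmod_ge_0 (k m)).
        rewrite (Cmod2_sqr (k m)), (Cmod2_sqr m), Hm in Hk0; nra. }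
  assert (Hle : Cmod2 (k 0%C) <= M * M).
  { apply Rnot_lt_le; intros Hlt.
    specialize (Heps ((Cmod2 (k 0%C) - M * M) / (2 * (r * r)))).
    assert (Hrr : 0 < r * r) by nra.
    replace ((Cmod2 (k 0%C) - M * M) / (2 * (r * r)) * (r * r))
      with ((Cmod2 (k 0%C) - M * M) / 2) in Heps by (field; lra).
    assert (0 < (Cmod2 (k 0%C) - M * M) / (2 * (r * r)))
      by (apply Rdiv_lt_0_compat; lra).
    specialize (Heps H); lra. }
  rewrite Cmod2_sqr in Hle; pose proof (Cmod_ge_0 (k 0%C)); nra.
Qed.

(** * Power series and their termwise derivative *)

Notation is_cpseries := (@is_pseries C_AbsRing C_NormedModule).

(** The radius of convergence is at least [r], in the form of Cauchy's
    estimates.  In this form it passes at once to shifted coefficients and to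
    coefficients multiplied by [n]. *)
Definition growth (c : nat -> C) (r : R) : Prop :=
  forall s, 0 < s < r -> exists B, forall n, Cmod (c n) * s ^ n <= B.

Lemma pow_n_Cpow (z : C) (n : nat) : @pow_n C_AbsRing z n = Cpow z n.
Proof. induction n as [|n IH]; simpl; [|rewrite IH]; reflexivity. Qed.

Lemma cpseries_unfold (c : nat -> C) (z l : C) :
  is_cpseries c z l <->
  @is_series C_AbsRing C_NormedModule (fun n => Cpow z n * c n)%C l.
Proof.
  assert (H : forall n,
    @scal C_AbsRing C_NormedModule (@pow_n C_AbsRing z n) (c n) = (Cpow z n * c n)%C).
  { intros n; now rewrite pow_n_Cpow. }
  split; apply is_series_ext; intros n; [|symmetry]; apply H.
Qed.

Lemma series_Cmod_le (u : nat -> C) (l : C) (b : nat -> R) (B : R) :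
  @is_series C_AbsRing C_NormedModule u l ->
  (forall n, Cmod (u n) <= b n) -> is_series b B -> Cmod l <= B.
Proof.
  intros Hu Hub Hb.
  apply (is_lim_seq_le (fun n => Cmod (sum_n u n)) (sum_n b) (Cmod l) B).
  - intros n; induction n as [|n IH].
    + rewrite !sum_O; apply Hub.
    + rewrite !sum_Sn.
      apply Rle_trans with (1 := Cmod_triangle _ _).
      apply Rplus_le_compat; auto.
  - unfold is_lim_seq; eapply filterlim_comp; [exact Hu|].
    apply (@filterlim_norm C_AbsRing C_NormedModule l).
  - exact Hb.
Qed.

Lemma growth_of_cpseries (c : nat -> C) (r : R) :
  (forall z, Cmod z < r -> exists l, is_cpseries c z l) -> growth c r.
Proof.
  intros H s Hs.
  destruct (H (RtoC s)) as [l Hl].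
  { rewrite Cmod_R, Rabs_pos_eq; lra. }
  apply cpseries_unfold in Hl.
  destruct (filterlim_bounded _ (ex_intro _ l Hl)) as [M HM].
  exists (M + M); intros n.
  replace (Cmod (c n) * s ^ n) with (Cmod (Cpow s n * c n)).
  2: { rewrite Cmod_mult, Cmod_pow, Cmod_R, Rabs_pos_eq by lra; ring. }
  assert (HM' : forall n, Cmod (sum_n (fun n => Cpow s n * c n)%C n) <= M) by exact HM.
  destruct n as [|n].
  - specialize (HM' 0%nat); rewrite sum_O in HM'.
    pose proof (Cmod_ge_0 (Cpow s 0 * c 0%nat)%C); lra.
  - pose proof (HM' (S n)) as H1; rewrite sum_Sn in H1.
    set (S0 := sum_n (fun n => Cpow s n * c n)%C n) in *.
    replace (Cpow s (S n) * c (S n))%C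
      with ((S0 + Cpow s (S n) * c (S n)) + - S0)%C by ring.
    apply Rle_trans with (1 := Cmod_triangle _ _).
    rewrite Cmod_opp; apply Rplus_le_compat; [exact H1 | apply HM'].
Qed.

Lemma growth_S (c : nat -> C) (r : R) : growth c r -> growth (fun n => c (S n)) r.
Proof.
  intros H s Hs; destruct (H s Hs) as [B HB].
  exists (B / s); intros n.
  apply Rmult_le_reg_r with s; [lra|].
  replace (B / s * s) with B by (field; lra).
  specialize (HB (S n)); simpl in HB; lra.
Qed.

Lemma INR_pow_le (q : R) (n : nat) : 0 <= q < 1 -> INR (S n) * q ^ n <= / (1 - q).
Proof.
  intros Hq.
  apply Rmult_le_reg_r with (1 - q); [lra|].
  rewrite Rinv_l by lra.
  assert (H : INR (S n) * q ^ n * (1 - q) <= 1 - q ^ S n).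
  { induction n as [|n IH]; [simpl; lra|].
    rewrite S_INR; simpl pow in *.
    assert (0 <= q ^ n) by (apply pow_le; lra).
    assert (q ^ n <= 1) by (rewrite <- (pow1 n); apply pow_incr; lra).
    assert (Hstep : q * (INR (S n) * q ^ n * (1 - q)) <= q * (1 - q * q ^ n))
      by (apply Rmult_le_compat_l; lra).
    assert (0 <= (1 - q * q ^ n) * (1 - q)) by (apply Rmult_le_pos; nra).
    nra. }
  assert (0 <= q ^ S n) by (apply pow_le; lra).
  lra.
Qed.

(** A factor [n] is absorbed by a slightly larger radius [s'], since
    [n (s/s')^n] is bounded. *)
Lemma growth_INR (c : nat -> C) (r : R) :
  growth c r -> growth (fun n => RtoC (INR (S n)) * c n)%C r.
Proof.
  intros H s Hs.
  destruct (H ((s + r) / 2)) as [B HB]; [lra|].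
  set (s' := (s + r) / 2) in *.
  assert (Hs' : s < s') by (unfold s'; lra).
  assert (Hq : 0 <= s / s' < 1).
  { split; [apply Rmult_le_pos; [lra | left; apply Rinv_0_lt_compat; lra]|].
    apply Rmult_lt_reg_r with s'; [lra|]; unfold Rdiv; rewrite Rmult_assoc, Rinv_l; lra. }
  exists (/ (1 - s / s') * B); intros n.
  rewrite Cmod_mult, Cmod_R, Rabs_pos_eq by apply pos_INR.
  replace (INR (S n) * Cmod (c n) * s ^ n)
    with ((INR (S n) * (s / s') ^ n) * (Cmod (c n) * s' ^ n)).
  2: { replace (s ^ n) with ((s / s') ^ n * s' ^ n); [ring|].
       rewrite <- Rpow_mult_distr; f_equal; field; lra. }
  apply Rmult_le_compat; auto using INR_pow_le.
  - apply Rmult_le_pos; [apply pos_INR | apply pow_le; lra].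
  - apply Rmult_le_pos; [apply Cmod_ge_0 | apply pow_le; lra].
Qed.

Lemma growth_geometric (c : nat -> C) (r s : R) :
  growth c r -> 0 <= s < r ->
  exists B q, 0 <= q < 1 /\ 0 <= B /\ forall n, Cmod (c n) * s ^ n <= B * q ^ n.
Proof.
  intros H Hs.
  destruct (H ((s + r) / 2)) as [B HB]; [lra|].
  set (s' := (s + r) / 2) in *.
  assert (Hs' : s < s') by (unfold s'; lra).
  assert (Hq : 0 <= s / s' < 1).
  { split; [apply Rmult_le_pos; [lra | left; apply Rinv_0_lt_compat; lra]|].
    apply Rmult_lt_reg_r with s'; [lra|]; unfold Rdiv; rewrite Rmult_assoc, Rinv_l; lra. }
  exists B, (s / s'); split; [assumption|split].
  - specialize (HB 0%nat); simpl in HB; pose proof (Cmod_ge_0 (c 0%nat)); lra.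
  - intros n.
    replace (s ^ n) with ((s / s') ^ n * s' ^ n).
    2: { rewrite <- Rpow_mult_distr; f_equal; field; lra. }
    assert (0 <= (s / s') ^ n) by (apply pow_le; lra).
    specialize (HB n); nra.
Qed.

Lemma is_series_geometric (B q : R) :
  0 <= q < 1 -> is_series (fun n => B * q ^ n) (B / (1 - q)).
Proof.
  intros Hq; apply (is_series_scal_l B (fun n => q ^ n)), is_series_geom.
  rewrite Rabs_pos_eq; lra.
Qed.

Lemma growth_ex_cpseries (c : nat -> C) (r : R) (z : C) :
  growth c r -> Cmod z < r -> exists l, is_cpseries c z l.
Proof.
  intros H Hz.
  destruct (growth_geometric c r (Cmod z) H) as (B & q & Hq & _ & HB).
  { split; [apply Cmod_ge_0 | assumption]. }
  assert (Hex : @ex_series C_AbsRing C_CompleteNormedModule (fun n => Cpow z n * c n)%C).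
  { apply ex_series_le with (b := fun n => B * q ^ n).
    - intros n.
      apply Rle_trans with (Cmod (c n) * Cmod z ^ n); [|apply HB].
      right; change (Cmod (Cpow z n * c n) = Cmod (c n) * Cmod z ^ n).
      rewrite Cmod_mult, Cmod_pow; ring.
    - exists (B / (1 - q)); now apply is_series_geometric. }
  destruct Hex as [l Hl]; exists l; apply cpseries_unfold, Hl.
Qed.

Lemma growth_sum_bounded (c : nat -> C) (r s : R) :
  growth c r -> 0 <= s < r ->
  exists K, forall z l, Cmod z <= s -> is_cpseries c z l -> Cmod l <= K.
Proof.
  intros H Hs.
  destruct (growth_geometric c r s H Hs) as (B & q & Hq & _ & HB).
  exists (B / (1 - q)); intros z l Hz Hl.
  apply cpseries_unfold in Hl.
  apply series_Cmod_le with (1 := Hl) (b := fun n => B * q ^ n);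
    [|now apply is_series_geometric].
  intros n; apply Rle_trans with (2 := HB n).
  rewrite Cmod_mult, Cmod_pow, Rmult_comm.
  apply Rmult_le_compat_l; [apply Cmod_ge_0|].
  apply pow_incr; split; [apply Cmod_ge_0 | assumption].
Qed.


(** The quotient [(f z - c0) / z] with the singularity at 0 filled in by [c1]. *)
Definition div_shift (f : C -> C) (c0 c1 : C) (z : C) : C :=
  if Ceq_dec z 0 then c1 else ((f z - c0) / z)%C.

Lemma cpseries_0 (c : nat -> C) : is_cpseries c (RtoC 0) (c 0%nat).
Proof. apply (@is_pseries_0 C_AbsRing C_NormedModule). Qed.

Lemma cpseries_unique (c : nat -> C) (z l l' : C) :
  is_cpseries c z l -> is_cpseries c z l' -> l = l'.
Proof.
  intros H H'; exact (filterlim_locally_unique _ _ _ H H').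
Qed.

Lemma div_shift_cpseries (f : C -> C) (c : nat -> C) (z : C) :
  is_cpseries c z (f z) ->
  is_cpseries (fun n => c (S n)) z (div_shift f (c 0%nat) (c 1%nat) z).
Proof.
  intros H; unfold div_shift; destruct (Ceq_dec z 0) as [-> | Hz].
  - apply (cpseries_0 (fun n => c (S n))).
  - replace ((f z - c 0%nat) / z)%C with (/ z * (f z - c 0%nat))%C
      by (field; assumption).
    apply (is_pseries_decr_1 (K := C_AbsRing) (V := C_NormedModule) c z (/ z)%C (f z));
      [|exact H].
    change (/ z * z = 1)%C; field; assumption.
Qed.

Lemma div_shift_eq (f : C -> C) (c : nat -> C) (z : C) :
  is_cpseries c z (f z) ->
  f z = (c 0%nat + z * div_shift f (c 0%nat) (c 1%nat) z)%C.
Proof.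
  intros H; unfold div_shift; destruct (Ceq_dec z 0) as [-> | Hz].
  - rewrite (cpseries_unique _ _ _ _ H (cpseries_0 c)); ring.
  - field; assumption.
Qed.

Definition sums_to (c : nat -> C) (r : R) (f : C -> C) : Prop :=
  forall z, Cmod z < r -> is_cpseries c z (f z).

Lemma growth_of_sums_to (c : nat -> C) (r : R) (f : C -> C) : sums_to c r f -> growth c r.
Proof. intros H; apply growth_of_cpseries; intros z Hz; exists (f z); auto. Qed.

Lemma sums_to_div_shift (c : nat -> C) (r : R) (f : C -> C) :
  sums_to c r f ->
  sums_to (fun n => c (S n)) r (div_shift f (c 0%nat) (c 1%nat)).
Proof. intros H z Hz; apply div_shift_cpseries; auto. Qed.

(** Three shifts write [f z] as [c0 + c1 z + c2 z^2 + z^3 f3 z], where [f3] is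
    again the sum of a power series and hence bounded near 0. *)
Lemma sums_to_jet (c : nat -> C) (r : R) (f : C -> C) :
  0 < r -> sums_to c r f -> jet f 0 (c 0%nat) (c 1%nat) (c 2%nat).
Proof.
  intros Hr H.
  pose proof (sums_to_div_shift _ _ _ H) as H1.
  pose proof (sums_to_div_shift _ _ _ H1) as H2.
  pose proof (sums_to_div_shift _ _ _ H2) as H3.
  simpl in H1, H2, H3.
  set (f1 := div_shift f _ _) in *.
  set (f2 := div_shift f1 _ _) in *.
  set (f3 := div_shift f2 _ _) in *.
  exists f3; split.
  - destruct (growth_sum_bounded _ r (r / 2) (growth_of_sums_to _ _ _ H3)) as [K HK]; [lra|].
    exists K, (r / 2); split; [lra|]; intros h Hh.
    apply (HK h); [lra | apply H3; lra].
  - exists r; split; [assumption|]; intros h Hh.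
    replace (0 + h)%C with h by ring.
    assert (E1 : f h = (c 0%nat + h * f1 h)%C) by (apply div_shift_eq; auto).
    assert (E2 : f1 h = (c 1%nat + h * f2 h)%C)
      by (apply (div_shift_eq f1 (fun n => c (S n))); auto).
    assert (E3 : f2 h = (c 2%nat + h * f3 h)%C)
      by (apply (div_shift_eq f2 (fun n => c (S (S n)))); auto).
    rewrite E1, E2, E3; ring.
Qed.

Lemma analytic_has_jet (f : C -> C) (z : C) :
  analytic_on_disc f -> in_disc z -> has_jet f z.
Proof.
  intros Hf Hz; destruct (Hf z Hz) as (c & r & Hr & H).
  exists (c 0%nat), (c 1%nat), (c 2%nat).
  assert (Hj : jet (fun h => f (z + h)%C) 0 (c 0%nat) (c 1%nat) (c 2%nat)).
  { apply sums_to_jet with (1 := Hr); intros h Hh.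
    specialize (H (z + h)%C).
    replace (z + h - z)%C with h in H by ring; auto. }
  destruct Hj as [E [HE Hj]]; exists E; split; [assumption|].
  revert Hj; apply near0_mono; intros h.
  now replace (0 + h)%C with h by ring.
Qed.

Definition deriv_coef (c : nat -> C) (n : nat) : C := (RtoC (INR (S n)) * c (S n))%C.

Lemma growth_deriv_coef (c : nat -> C) (r : R) : growth c r -> growth (deriv_coef c) r.
Proof. intros H; apply (growth_INR (fun n => c (S n))), growth_S, H. Qed.

(** The derivative of the [n]-th power, split at [n = 0] to avoid the exponent
    [n - 1]. *)
Definition dpow (z : C) (n : nat) : C :=
  match n with O => 0%C | S m => (RtoC (INR (S m)) * Cpow z m)%C end.

Lemma dpow_S (z : C) (n : nat) : dpow z (S n) = (z * dpow z n + Cpow z n)%C.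
Proof.
  destruct n as [|n]; simpl dpow; [simpl; ring|].
  change (match n with O => 1 | S _ => INR n + 1 end) with (INR (S n)).
  rewrite RtoC_plus; simpl; ring.
Qed.

(** The factor [s * s] on the left replaces [s^(n-2)] on the right.  The error
    [E n] satisfies [E (n+1) = (z+h) E n + h^2 dpow z n], which gives the
    induction. *)
Lemma Cpow_dpow_bound (z h : C) (s : R) (n : nat) :
  Cmod z + Cmod h <= s ->
  s * s * Cmod (Cpow (z + h) n - Cpow z n - h * dpow z n)%C
    <= INR n * INR n * (Cmod h * Cmod h) * s ^ n.
Proof.
  intros Hs.
  pose proof (Cmod_ge_0 z); pose proof (Cmod_ge_0 h).
  assert (Hd : forall m, s * Cmod (dpow z m) <= INR m * s ^ m).
  { intros [|m]; simpl dpow; [rewrite Cmod_0; simpl; lra|].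
    rewrite Cmod_mult, Cmod_R, Rabs_pos_eq, Cmod_pow by apply (pos_INR (S m)).
    change (match m with O => 1 | S _ => INR m + 1 end) with (INR (S m)).
    assert (Cmod z ^ m <= s ^ m) by (apply pow_incr; lra).
    simpl pow; pose proof (pos_INR (S m)).
    assert (INR (S m) * Cmod z ^ m <= INR (S m) * s ^ m) by nra.
    nra. }
  induction n as [|n IH].
  - replace (Cpow (z + h) 0 - Cpow z 0 - h * dpow z 0)%C with (RtoC 0)
      by (cbn [Cpow dpow]; ring).
    rewrite Cmod_0; simpl; lra.
  - rewrite dpow_S; simpl Cpow.
    set (E := (Cpow (z + h) n - Cpow z n - h * dpow z n)%C) in *.
    replace ((z + h) * Cpow (z + h) n - z * Cpow z n - h * (z * dpow z n + Cpow z n))%C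
      with ((z + h) * E + h * h * dpow z n)%C by (unfold E; ring).
    apply Rle_trans with (s * s * (s * Cmod E + Cmod h * Cmod h * Cmod (dpow z n))).
    { apply Rmult_le_compat_l; [nra|].
      apply Rle_trans with (1 := Cmod_triangle _ _).
      rewrite !Cmod_mult.
      apply Rplus_le_compat_r, Rmult_le_compat_r; [apply Cmod_ge_0|].
      pose proof (Cmod_triangle z h); lra. }
    rewrite S_INR; simpl pow.
    specialize (Hd n).
    assert (0 <= s ^ n) by (apply pow_le; lra).
    assert (0 <= Cmod h * Cmod h) by nra.
    assert (Hb1 : s * (s * s * Cmod E) <= s * (INR n * INR n * (Cmod h * Cmod h) * s ^ n))
      by (apply Rmult_le_compat_l; lra).
    assert (Hb2 : s * (Cmod h * Cmod h) * (s * Cmod (dpow z n))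
      <= s * (Cmod h * Cmod h) * (INR n * s ^ n)).
    { apply Rmult_le_compat_l; nra. }
    pose proof (pos_INR n).
    assert (0 <= s * (Cmod h * Cmod h) * s ^ n) by (repeat apply Rmult_le_pos; lra).
    nra.
Qed.

Lemma is_derive_of_quadratic_error (f : C -> C) (z l : C) (K d : R) :
  0 < d ->
  (forall h, Cmod h < d -> Cmod (f (z + h) - f z - h * l)%C <= K * (Cmod h * Cmod h)) ->
  @is_derive C_AbsRing C_NormedModule f z l.
Proof.
  intros Hd H.
  split; [apply (@is_linear_scal_l C_AbsRing C_NormedModule)|].
  intros x Hx.
  apply (@is_filter_lim_locally_unique _ (AbsRing_NormedModule C_AbsRing)) in Hx; subst x.
  intros eps.
  pose proof (Rabs_pos K); pose proof (Rle_abs K); pose proof (cond_pos eps).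
  assert (Hd' : 0 < Rmin d (eps / (Rabs K + 1))).
  { apply Rmin_pos; [assumption | apply Rdiv_lt_0_compat; lra]. }
  exists (mkposreal _ Hd'); intros y Hy; change C in y.
  change (Cmod (y - z)%C < Rmin d (eps / (Rabs K + 1))) in Hy.
  change (Cmod ((f y - f z) - (y - z) * l)%C <= eps * Cmod (y - z)%C).
  pose proof (Rmin_l d (eps / (Rabs K + 1))).
  pose proof (Rmin_r d (eps / (Rabs K + 1))).
  specialize (H (y - z)%C ltac:(lra)).
  replace (z + (y - z))%C with y in H by ring.
  apply Rle_trans with (1 := H).
  pose proof (Cmod_ge_0 (y - z)%C).
  assert (Cmod (y - z)%C * (Rabs K + 1) <= eps).
  { replace (pos eps) with (eps / (Rabs K + 1) * (Rabs K + 1)) by (field; lra).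
    apply Rmult_le_compat_r; lra. }
  nra.
Qed.

Lemma cpseries_dpow (c : nat -> C) (z l : C) :
  is_cpseries (deriv_coef c) z l ->
  @is_series C_AbsRing C_NormedModule (fun n => dpow z n * c n)%C l.
Proof.
  intros H; apply cpseries_unfold in H.
  apply is_series_decr_1.
  replace (plus _ _) with l.
  2: { change (l = l + - (0 * c 0%nat))%C; ring. }
  revert H; apply is_series_ext; intros n.
  unfold deriv_coef, dpow.
  change (Cpow z n * (INR (S n) * c (S n)) = INR (S n) * Cpow z n * c (S n))%C; ring.
Qed.

(** The terms of the series of [f (z+h) - f z - h l] are at most [|h|^2]
    times the terms of a convergent geometric series, so the error is
    [O(|h|^2)]. *)
Lemma sums_to_is_derive (c : nat -> C) (r : R) (f : C -> C) (z l : C) :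
  sums_to c r f -> Cmod z < r -> is_cpseries (deriv_coef c) z l ->
  @is_derive C_AbsRing C_NormedModule f z l.
Proof.
  intros Hf Hz Hl.
  pose proof (Cmod_ge_0 z) as Hz0.
  set (s := (Cmod z + r) / 2).
  assert (Hs : Cmod z < s < r) by (unfold s; lra).
  (* Two factors [n] compensate the [n^2] in the estimate of the powers. *)
  pose proof (growth_INR _ _ (growth_INR _ _ (growth_of_sums_to _ _ _ Hf))) as Hg.
  destruct (growth_geometric _ _ s Hg) as (B & q & Hq & HB0 & HB); [lra|].
  apply is_derive_of_quadratic_error
    with (K := / (s * s) * (B / (1 - q))) (d := s - Cmod z); [lra|].
  intros h Hh.
  assert (Hh0 : Cmod (z + h)%C < r) by (pose proof (Cmod_triangle z h); lra).
  pose proof (proj1 (cpseries_unfold _ _ _) (Hf _ Hz)) as S1.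
  pose proof (proj1 (cpseries_unfold _ _ _) (Hf _ Hh0)) as S2.
  pose proof (is_series_scal h _ _ (cpseries_dpow _ _ _ Hl)) as S3.
  pose proof (is_series_minus _ _ _ _ (is_series_minus _ _ _ _ S2 S1) S3) as S4.
  change (@is_series C_AbsRing C_NormedModule
    (fun n => (Cpow (z + h) n * c n + - (Cpow z n * c n)) + - (h * (dpow z n * c n)))%C
    (f (z + h)%C + - f z + - (h * l))%C) in S4.
  replace (f (z + h)%C - f z - h * l)%C
    with (f (z + h)%C + - f z + - (h * l))%C by ring.
  pose (b := fun n => / (s * s) * (Cmod h * Cmod h) * B * q ^ n).
  replace (/ (s * s) * (B / (1 - q)) * (Cmod h * Cmod h))
    with (/ (s * s) * (Cmod h * Cmod h) * B / (1 - q)) by (field; split; lra).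
  apply series_Cmod_le with (1 := S4) (b := b); [|now apply is_series_geometric].
  intros n; unfold b.
  replace (Cpow (z + h) n * c n + - (Cpow z n * c n) + - (h * (dpow z n * c n)))%C
    with ((Cpow (z + h) n - Cpow z n - h * dpow z n) * c n)%C by ring.
  rewrite Cmod_mult.
  pose proof (Cpow_dpow_bound z h s n ltac:(lra)) as Hb.
  specialize (HB n).
  rewrite !Cmod_mult, Cmod_R, Rabs_pos_eq in HB by apply pos_INR.
  set (e := Cmod (Cpow (z + h) n - Cpow z n - h * dpow z n)%C) in *.
  assert (Hss : 0 < s * s) by nra.
  apply Rmult_le_reg_l with (s * s); [assumption|].
  replace (s * s * (/ (s * s) * (Cmod h * Cmod h) * B * q ^ n))
    with (Cmod h * Cmod h * (B * q ^ n)) by (field; lra).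
  assert (Hc := Cmod_ge_0 (c n)); assert (Hh2 := Cmod_ge_0 h).
  apply Rle_trans with (INR n * INR n * (Cmod h * Cmod h) * s ^ n * Cmod (c n)).
  { rewrite <- Rmult_assoc; apply Rmult_le_compat_r; assumption. }
  apply Rle_trans with (Cmod h * Cmod h *
    (INR (S n) * (INR (S n) * Cmod (c n)) * s ^ n)).
  2: { apply Rmult_le_compat_l; [nra | assumption]. }
  assert (Hn : INR n * INR n <= INR (S n) * INR (S n)).
  { rewrite S_INR; pose proof (pos_INR n); nra. }
  assert (Hpos : 0 <= Cmod h * Cmod h * (Cmod (c n) * s ^ n)).
  { apply Rmult_le_pos; [nra|]; apply Rmult_le_pos; [lra | apply pow_le; lra]. }
  nra.
Qed.

Lemma sums_to_C_derive (c : nat -> C) (r : R) (f : C -> C) :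
  sums_to c r f -> sums_to (deriv_coef c) r (C_derive f).
Proof.
  intros Hf z Hz.
  destruct (growth_ex_cpseries (deriv_coef c) r z) as [l Hl]; auto.
  { eapply growth_deriv_coef, growth_of_sums_to, Hf. }
  rewrite (is_C_derive_unique f z l); [assumption|].
  now apply sums_to_is_derive with (1 := Hf).
Qed.

(** * The second Taylor coefficient of a bounded function *)

Lemma RtoC_neq0 (x : R) : x <> 0 -> RtoC x <> 0%C.
Proof. intros Hx H; apply Hx; now injection H. Qed.

Lemma has_jet_mult (f g : C -> C) (z : C) :
  has_jet f z -> has_jet g z -> has_jet (fun w => f w * g w)%C z.
Proof.
  intros (c0 & c1 & c2 & Hf) (d0 & d1 & d2 & Hg).
  do 3 eexists; eapply jet_mult; eassumption.
Qed.

Lemma has_jet_even_part (f : C -> C) (z : C) :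
  has_jet f z -> has_jet f (- z)%C -> has_jet (fun w => (f w + f (- w)) * / 2)%C z.
Proof.
  intros (c0 & c1 & c2 & Hf) (d0 & d1 & d2 & Hg).
  do 3 eexists; eapply jet_mult; [|apply jet_const].
  apply jet_plus; [eassumption | apply jet_opp_arg; eassumption].
Qed.

(** The even part of [w] is [c2 z^2 + O(z^4)] and bounded by 1, so its quotient
    by [z^2] has the value [c2] at 0 and is at most [1/r^2] on [|z| = r].  By the
    maximum principle [|c2| <= 1/r^2] for all [r < 1].  Taking the even part
    removes the term [c1 z]. *)
Lemma second_coefficient_bound (w : C -> C) (c0 c1 c2 : C) :
  analytic_on_disc w -> w 0%C = 0%C ->
  (forall z, in_disc z -> Cmod (w z) < 1) ->
  jet w 0 c0 c1 c2 -> Cmod c2 <= 1.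
Proof.
  intros Han H0 Hbd Hj.
  assert (H2 : RtoC 2 <> 0%C) by (apply RtoC_neq0; lra).
  destruct (Han 0%C) as (c & rho & Hrho & Hc).
  { unfold in_disc; rewrite Cmod_0; lra. }
  assert (Hw : sums_to c rho w).
  { intros z Hz; specialize (Hc z); replace (z - 0)%C with z in Hc by ring; auto. }
  assert (Hcc : c2 = c 2%nat).
  { apply (jet_unique _ _ _ _ _ _ _ _ _ Hj (sums_to_jet _ _ _ Hrho Hw)).
    exists 1; split; [lra | auto]. }
  assert (Hc0 : c 0%nat = 0%C) by now rewrite <- (jet_value _ _ _ _ _ (sums_to_jet _ _ _ Hrho Hw)).
  pose proof (sums_to_div_shift _ _ _ Hw) as Hw1.
  pose proof (sums_to_div_shift _ _ _ Hw1) as Hw2.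
  simpl in Hw1, Hw2.
  set (w1 := div_shift w _ _) in *.
  set (w2 := div_shift w1 _ _) in *.
  assert (Hexp : forall z, Cmod z < rho -> w z = (z * c 1%nat + z * z * w2 z)%C).
  { intros z Hz.
    assert (E1 : w z = (c 0%nat + z * w1 z)%C) by (apply div_shift_eq; auto).
    assert (E2 : w1 z = (c 1%nat + z * w2 z)%C)
      by (apply (div_shift_eq w1 (fun n => c (S n))); auto).
    rewrite E1, E2, Hc0; ring. }
  pose proof (sums_to_jet _ _ _ Hrho Hw2) as Hj2; simpl in Hj2.
  pose (k := fun z => if Ceq_dec z 0 then c2
                      else ((w z + w (- z)) * / 2 * (/ z * / z))%C).
  assert (Hk0 : k 0%C = c2) by (unfold k; destruct (Ceq_dec 0 0); congruence).
  assert (Hkjet : forall z, in_disc z -> has_jet k z).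
  { intros z Hz.
    destruct (Ceq_dec z 0) as [-> | Hz0].
    - destruct (has_jet_even_part w2 0) as (d0 & d1 & d2 & Hd).
      { do 3 eexists; exact Hj2. }
      { replace (- 0)%C with (RtoC 0) by ring; do 3 eexists; exact Hj2. }
      exists d0, d1, d2; revert Hd; apply jet_ext.
      exists rho; split; [assumption|]; intros h Hh.
      replace (0 + h)%C with h by ring.
      unfold k; destruct (Ceq_dec h 0) as [-> | Hh0].
      + replace (- 0)%C with (RtoC 0) by ring.
        rewrite (jet_value _ _ _ _ _ Hj2), Hcc; field; assumption.
      + rewrite (Hexp h), (Hexp (- h)%C) by (rewrite ?Cmod_opp; assumption).
        field; assumption.
    - assert (Hopp : in_disc (- z)%C) by (unfold in_disc; now rewrite Cmod_opp).
      destruct (jet_inv_id z Hz0) as (e0 & e1 & e2 & He).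
      assert (Hinv : has_jet (fun w => / w)%C z) by (do 3 eexists; exact He).
      destruct (has_jet_mult _ _ z
        (has_jet_even_part w z (analytic_has_jet _ _ Han Hz) (analytic_has_jet _ _ Han Hopp))
        (has_jet_mult _ _ z Hinv Hinv)) as (d0 & d1 & d2 & Hd).
      exists d0, d1, d2; revert Hd; apply jet_ext.
      generalize (jet_neq0 _ _ _ _ _ (jet_id z) Hz0); apply near0_mono; intros h Hh.
      unfold k; destruct (Ceq_dec (z + h) 0); [contradiction | reflexivity]. }
  assert (Hr : forall r, 0 < r < 1 -> Cmod c2 * (r * r) <= 1).
  { intros r Hr.
    assert (Hrr : 0 < r * r) by nra.
    assert (Hmax : Cmod (k 0%C) <= / (r * r)).
    { apply maximum_principle with (r := r); [lra | | |].
      - left; apply Rinv_0_lt_compat; assumption.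
      - intros z Hz; apply Hkjet; unfold in_disc; lra.
      - intros z Hz.
        assert (Hz0 : z <> 0%C) by (apply Cmod_gt_0; lra).
        unfold k; destruct (Ceq_dec z 0); [contradiction|].
        rewrite !Cmod_mult, !Cmod_inv, Cmod_R, Rabs_pos_eq, Hz by (assumption || lra).
        rewrite <- Rinv_mult.
        rewrite <- (Rmult_1_l (/ (r * r))) at 2.
        apply Rmult_le_compat_r; [left; apply Rinv_0_lt_compat; assumption|].
        pose proof (Cmod_triangle (w z) (w (- z)%C)).
        pose proof (Hbd z ltac:(unfold in_disc; lra)).
        pose proof (Hbd (- z)%C ltac:(unfold in_disc; rewrite Cmod_opp; lra)).
        lra. }
    rewrite Hk0 in Hmax.
    replace 1 with (/ (r * r) * (r * r)) by (field; lra).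
    apply Rmult_le_compat_r; lra. }
  apply Rnot_lt_le; intros Hlt.
  (* With [r = (x+1)/(2x) < 1], [x r^2 = 1 + (x-1)^2/(4x)] exceeds 1. *)
  set (x := Cmod c2) in *.
  assert (Hx1 : (x + 1) / (2 * x) < 1).
  { apply Rmult_lt_reg_r with (2 * x); [lra|].
    replace ((x + 1) / (2 * x) * (2 * x)) with (x + 1) by (field; lra); lra. }
  specialize (Hr ((x + 1) / (2 * x))).
  replace (x * ((x + 1) / (2 * x) * ((x + 1) / (2 * x))))
    with (1 + (x - 1) * (x - 1) / (4 * x)) in Hr by (field; lra).
  assert (0 < (x - 1) * (x - 1) / (4 * x)) by (apply Rdiv_lt_0_compat; nra).
  assert (0 < (x + 1) / (2 * x)) by (apply Rdiv_lt_0_compat; lra).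
  lra.
Qed.

(** * Coefficients of [s_fun], of the Hadamard products and of the inverse *)

(** Mean value theorem.  Together with [neg_power_derive], which maps the family
    [neg_power c] to itself up to a factor, this raises the order of a Taylor
    estimate by one at each use. *)
Lemma integrate_bound (h h' : R -> R) (K d : R) (n : nat) :
  h 0 = 0 ->
  (forall x, 0 <= x <= d -> is_derive h x (h' x)) ->
  (forall x, 0 <= x <= d -> Rabs (h' x) <= K * x ^ n) ->
  forall x, 0 <= x <= d -> Rabs (h x) <= K * x ^ S n.
Proof.
  intros H0 Hd Hb x Hx.
  destruct (MVT_gen h 0 x h') as [xi [Hxi Heq]].
  - intros y Hy; rewrite Rmin_left, Rmax_right in Hy by lra; apply Hd; lra.
  - intros y Hy; rewrite Rmin_left, Rmax_right in Hy by lra.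
    apply continuity_pt_filterlim.
    apply (@ex_derive_continuous R_AbsRing R_NormedModule h y).
    exists (h' y); apply Hd; lra.
  - rewrite Rmin_left, Rmax_right in Hxi by lra.
    rewrite H0, !Rminus_0_r in Heq.
    rewrite Heq, Rabs_mult, (Rabs_pos_eq x) by lra.
    assert (HK : 0 <= K \/ x = 0).
    { destruct (Req_dec x 0) as [|Hx0]; [now right | left].
      specialize (Hb x Hx); pose proof (Rabs_pos (h' x)).
      assert (0 < x ^ n) by (apply pow_lt; lra).
      apply Rnot_lt_le; intros HK; nra. }
    destruct HK as [HK | ->]; [|simpl; lra].
    simpl pow.
    specialize (Hb xi ltac:(lra)).
    assert (xi ^ n <= x ^ n) by (apply pow_incr; lra).
    assert (Rabs (h' xi) <= K * x ^ n) by nra.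
    nra.
Qed.

(** [(1 - x)^(-c)] for [x < 1]. *)
Definition neg_power (c x : R) : R := exp (- c * ln (1 - x)).

Lemma neg_power_derive (c x : R) :
  x < 1 -> is_derive (neg_power c) x (c * neg_power (c + 1) x).
Proof.
  intros Hx; unfold neg_power.
  auto_derive; [lra|].
  replace (- (c + 1) * ln (1 - x)) with (- c * ln (1 - x) + - ln (1 - x)) by ring.
  rewrite exp_plus, exp_Ropp, exp_ln by lra.
  unfold Rminus; field; lra.
Qed.

Lemma neg_power_0 (c : R) : neg_power c 0 = 1.
Proof. unfold neg_power; rewrite Rminus_0_r, ln_1, Rmult_0_r; apply exp_0. Qed.

Lemma neg_power_bounded (c : R) :
  0 <= c -> exists K, forall x, 0 <= x <= / 2 -> Rabs (neg_power c x) <= K.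
Proof.
  intros Hc; exists (exp (- c * ln (/ 2))); intros x Hx.
  unfold neg_power; rewrite Rabs_pos_eq by (left; apply exp_pos).
  assert (Hln : ln (/ 2) <= ln (1 - x)) by (apply ln_le; lra).
  assert (Hle : - c * ln (1 - x) <= - c * ln (/ 2)) by nra.
  destruct Hle as [Hle | ->]; [left; now apply exp_increasing | lra].
Qed.

Lemma neg_power_order0 (c : R) : 0 <= c -> exists K, forall x, 0 <= x <= / 2 ->
  Rabs (neg_power c x - 1) <= K * x ^ 1.
Proof.
  intros Hc.
  destruct (neg_power_bounded (c + 1)) as [K HK]; [lra|].
  exists (c * K).
  apply integrate_bound with (h' := fun x => c * neg_power (c + 1) x).
  - rewrite neg_power_0; ring.
  - intros x Hx; pose proof (neg_power_derive c x ltac:(lra)) as Hd.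
    auto_derive; [exists (c * neg_power (c + 1) x); exact Hd|].
    rewrite (is_derive_unique (fun y : R => neg_power c y) _ _ Hd); ring.
  - intros x Hx; specialize (HK x Hx).
    rewrite Rabs_mult, (Rabs_pos_eq c) by lra; simpl; nra.
Qed.

Lemma neg_power_order1 (c : R) : 0 <= c -> exists K, forall x, 0 <= x <= / 2 ->
  Rabs (neg_power c x - 1 - c * x) <= K * x ^ 2.
Proof.
  intros Hc.
  destruct (neg_power_order0 (c + 1)) as [K HK]; [lra|].
  exists (c * K).
  apply integrate_bound with (h' := fun x => c * (neg_power (c + 1) x - 1)).
  - rewrite neg_power_0; ring.
  - intros x Hx; pose proof (neg_power_derive c x ltac:(lra)) as Hd.
    auto_derive; [exists (c * neg_power (c + 1) x); exact Hd|].
    rewrite (is_derive_unique (fun y : R => neg_power c y) _ _ Hd); ring.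
  - intros x Hx; specialize (HK x Hx).
    rewrite Rabs_mult, (Rabs_pos_eq c) by lra; nra.
Qed.

Lemma neg_power_order2 (c : R) : 0 <= c -> exists K, forall x, 0 <= x <= / 2 ->
  Rabs (neg_power c x - 1 - c * x - c * (c + 1) / 2 * (x * x)) <= K * x ^ 3.
Proof.
  intros Hc.
  destruct (neg_power_order1 (c + 1)) as [K HK]; [lra|].
  exists (c * K).
  apply integrate_bound with (h' := fun x => c * (neg_power (c + 1) x - 1 - (c + 1) * x)).
  - rewrite neg_power_0; field.
  - intros x Hx; pose proof (neg_power_derive c x ltac:(lra)) as Hd.
    auto_derive; [exists (c * neg_power (c + 1) x); exact Hd|].
    rewrite (is_derive_unique (fun y : R => neg_power c y) _ _ Hd); field.
  - intros x Hx; specialize (HK x Hx).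
    rewrite Rabs_mult, (Rabs_pos_eq c) by lra; nra.
Qed.

(** The estimate for [u] lives on a real interval, whereas a jet needs a complex
    neighbourhood: the real error is extended to all [z] as a function of the
    real part of [z]. *)
Lemma jet_coefficients_real (f : C -> C) (c0 c1 c2 : C) (u : R -> R) (d0 d1 d2 K r : R) :
  jet f 0 c0 c1 c2 -> 0 < r ->
  (forall x, 0 < x <= r -> f (RtoC x) = RtoC (u x)) ->
  (forall x, 0 < x <= r -> Rabs (u x - d0 - d1 * x - d2 * (x * x)) <= K * x ^ 3) ->
  c0 = RtoC d0 /\ c1 = RtoC d1 /\ c2 = RtoC d2.
Proof.
  intros Hj Hr Hf Hu.
  pose (e := fun x => if Rlt_dec 0 x
                      then (u x - d0 - d1 * x - d2 * (x * x)) / (x * x * x) else 0).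
  pose (g := fun z : C =>
    (RtoC d0 + RtoC d1 * z + RtoC d2 * (z * z) + z * z * z * RtoC (e (fst z)))%C).
  apply (jet_unique f g 0); [assumption | |].
  - exists (fun z => RtoC (e (fst z))); split.
    + exists (Rabs K), r; split; [assumption|]; intros h Hh.
      rewrite Cmod_R.
      pose proof (re_le_Cmod h) as Hre; unfold Re in Hre.
      pose proof (Rle_abs (fst h)).
      unfold e; destruct (Rlt_dec 0 (fst h)) as [Hp|]; [|rewrite Rabs_R0; apply Rabs_pos].
      set (x := fst h) in *.
      assert (Hx3 : 0 < x * x * x) by (repeat apply Rmult_lt_0_compat; assumption).
      specialize (Hu x ltac:(lra)).
      unfold Rdiv; rewrite Rabs_mult, Rabs_inv, (Rabs_pos_eq (x * x * x)) by lra.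
      apply Rmult_le_reg_r with (x * x * x); [assumption|].
      rewrite Rmult_assoc, Rinv_l, Rmult_1_r by lra.
      pose proof (Rle_abs K); simpl in Hu; nra.
    + apply near0_all; intros h; unfold g; now replace (0 + h)%C with h by ring.
  - exists r; split; [assumption|]; intros x Hx.
    replace (0 + x)%C with (RtoC x) by ring.
    rewrite Hf by lra; unfold g, e; cbn [fst RtoC].
    destruct (Rlt_dec 0 x) as [_|]; [|lra].
    rewrite <- !RtoC_mult, <- !RtoC_plus; f_equal; field; lra.
Qed.

Lemma Psi_2 (alpha : R) : Psi 2 alpha = 2 - 2 * alpha.
Proof. unfold Psi; simpl; field. Qed.

Lemma Psi_3 (alpha : R) : Psi 3 alpha = (2 - 2 * alpha) * (3 - 2 * alpha) / 2.
Proof. unfold Psi; simpl; field. Qed.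

Lemma s_fun_real (alpha x : R) :
  0 < x < 1 -> s_fun alpha (RtoC x) = (x * neg_power (2 * (1 - alpha)) x)%C.
Proof.
  intros Hx; unfold s_fun, principal_power.
  replace (RtoC 1 - RtoC x)%C with (RtoC (1 - x)) by now rewrite RtoC_minus.
  rewrite Cmod_R, Rabs_pos_eq by lra.
  cbn [Im Re RtoC fst snd].
  replace (0 / (1 - x)) with 0 by (field; lra).
  rewrite atan_0, Rmult_0_r, cos_0, sin_0.
  set (c := 2 * (1 - alpha)).
  change (1, 0) with (RtoC 1); rewrite Cmult_1_r.
  unfold Cdiv; rewrite <- RtoC_inv by (apply Rgt_not_eq, exp_pos); f_equal.
  unfold neg_power, Rpower.
  replace (- c * ln (1 - x)) with (- (c * ln (1 - x))) by ring.
  now rewrite exp_Ropp.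
Qed.

(** The power series of a factor in [hadamard_product] is existentially
    quantified; up to the third coefficient this identifies it with any other
    expansion of the same function. *)
Lemma sums_to_coef_unique (a b : nat -> C) (r : R) (f : C -> C) :
  0 < r -> sums_to a r f -> sums_to b r f ->
  a 0%nat = b 0%nat /\ a 1%nat = b 1%nat /\ a 2%nat = b 2%nat /\ a 3%nat = b 3%nat.
Proof.
  intros Hr Ha Hb.
  assert (Hrefl : forall g : C -> C, exists s, 0 < s /\
    forall x : R, 0 < x < s -> g (0 + x)%C = g (0 + x)%C)
    by (intros g; exists 1; split; [lra | auto]).
  destruct (jet_unique _ _ _ _ _ _ _ _ _ (sums_to_jet _ _ _ Hr Ha) (sums_to_jet _ _ _ Hr Hb)
    (Hrefl f)) as (H0 & H1 & H2).
  pose proof (sums_to_jet _ _ _ Hr (sums_to_div_shift _ _ _ Ha)) as Ja.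
  pose proof (sums_to_jet _ _ _ Hr (sums_to_div_shift _ _ _ Hb)) as Jb.
  rewrite H0, H1 in Ja.
  destruct (jet_unique _ _ _ _ _ _ _ _ _ Ja Jb (Hrefl _)) as (_ & _ & H3).
  auto.
Qed.

Lemma s_fun_coefficients (alpha : R) (a : nat -> C) :
  0 <= alpha < 1 -> power_series_on_disc a (s_fun alpha) ->
  a 0%nat = 0%C /\ a 1%nat = 1%C /\ a 2%nat = RtoC (Psi 2 alpha) /\
  a 3%nat = RtoC (Psi 3 alpha).
Proof.
  intros Hal Ha.
  assert (Hs : sums_to a 1 (s_fun alpha)) by exact Ha.
  assert (H0 : a 0%nat = 0%C).
  { rewrite <- (jet_value _ _ _ _ _ (sums_to_jet _ _ _ Rlt_0_1 Hs)).
    unfold s_fun, Cdiv; ring. }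
  destruct (neg_power_order2 (2 * (1 - alpha))) as [K HK]; [lra|].
  destruct (jet_coefficients_real _ _ _ _ (neg_power (2 * (1 - alpha)))
    1 (2 * (1 - alpha)) (2 * (1 - alpha) * (2 * (1 - alpha) + 1) / 2) K (/ 2)
    (sums_to_jet _ _ _ Rlt_0_1 (sums_to_div_shift _ _ _ Hs))) as (H1 & H2 & H3).
  - lra.
  - intros x Hx.
    assert (Hx0 : RtoC x <> 0%C) by (apply RtoC_neq0; lra).
    unfold div_shift; destruct (Ceq_dec x 0); [contradiction|].
    rewrite s_fun_real, H0 by lra; field; assumption.
  - intros x Hx; apply HK; lra.
  - rewrite Psi_2, Psi_3; repeat split; [assumption | assumption | |].
    + rewrite H2; f_equal; ring.
    + rewrite H3; f_equal; field.
Qed.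

Lemma hadamard_s_fun_coefficients (alpha : R) (a : nat -> C) (f F : C -> C) :
  0 <= alpha < 1 -> power_series_on_disc a f -> hadamard_product (s_fun alpha) f F ->
  exists A : nat -> C, sums_to A 1 F /\
    A 0%nat = 0%C /\ A 1%nat = a 1%nat /\ A 2%nat = (Psi 2 alpha * a 2%nat)%C /\
    A 3%nat = (Psi 3 alpha * a 3%nat)%C.
Proof.
  intros Hal Ha (s & b & Hs & Hb & HF).
  destruct (s_fun_coefficients alpha s Hal Hs) as (S0 & S1 & S2 & S3).
  destruct (sums_to_coef_unique a b 1 f Rlt_0_1 Ha Hb) as (B0 & B1 & B2 & B3).
  exists (fun n => s n * b n)%C; split; [exact HF|].
  rewrite S0, S1, S2, S3, B1, B2, B3; repeat split; ring.
Qed.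

(** With [f z = z W z] and [g w = w V w], the equation [f (g w) = w] becomes
    [V w * W (g w) = 1], an identity between jets. *)
Lemma inverse_coefficients (a b : nat -> C) (f g : C -> C) (rho : R) :
  a 0%nat = 0%C -> a 1%nat = 1%C -> sums_to a 1 f -> sums_to b 1 g ->
  g 0%C = 0%C -> 0 < rho ->
  (forall w, Cmod w < rho -> Cmod (g w) < 1 /\ f (g w) = w) ->
  b 1%nat = 1%C /\ b 2%nat = (- a 2%nat)%C /\
  b 3%nat = (2 * (a 2%nat * a 2%nat) - a 3%nat)%C.
Proof.
  intros Ha0 Ha1 Hf Hg Hg0 Hrho Hinv.
  pose proof (sums_to_jet _ _ _ Rlt_0_1 Hg) as Jg.
  pose proof (jet_value _ _ _ _ _ Jg) as Hb0; rewrite Hg0 in Hb0.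
  rewrite <- Hb0 in Jg.
  pose proof (sums_to_jet _ _ _ Rlt_0_1 (sums_to_div_shift _ _ _ Hf)) as JW.
  pose proof (sums_to_jet _ _ _ Rlt_0_1 (sums_to_div_shift _ _ _ Hg)) as JV.
  simpl in JW, JV.
  pose proof (jet_mult _ _ _ _ _ _ _ _ _ JV (jet_comp _ _ _ _ _ _ _ _ _ Jg JW)) as J.
  destruct (jet_unique _ _ _ _ _ _ _ _ _ J (jet_const 1 0)) as (E0 & E1 & E2).
  { exists (Rmin rho 1); split; [apply Rmin_pos; lra|]; intros x Hx.
    pose proof (Rmin_l rho 1); pose proof (Rmin_r rho 1).
    replace (0 + x)%C with (RtoC x) by ring.
    assert (Hx0 : RtoC x <> 0%C) by (apply RtoC_neq0; lra).
    assert (Hmx : Cmod x = x) by (rewrite Cmod_R; apply Rabs_pos_eq; lra).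
    destruct (Hinv x) as [Hin Hfg]; [lra|].
    assert (EV : g x = (b 0%nat + x * div_shift g (b 0%nat) (b 1%nat) x)%C)
      by (apply div_shift_eq, Hg; lra).
    assert (EW : f (g x) = (a 0%nat + g x * div_shift f (a 0%nat) (a 1%nat) (g x))%C)
      by (apply div_shift_eq, Hf; exact Hin).
    set (V := div_shift g _ _ _) in *.
    set (W := div_shift f _ _ _) in *.
    rewrite Hfg, Ha0 in EW; rewrite <- Hb0 in EV.
    replace (V * W)%C with ((0 + (0 + x * V) * W) / x)%C by (field; assumption).
    rewrite <- EV, <- EW; field; assumption. }
  rewrite Ha1 in *.
  assert (B1 : b 1%nat = 1%C) by (rewrite <- E0; ring).
  rewrite B1 in *.
  assert (B2 : b 2%nat = (- a 2%nat)%C).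
  { replace (b 2%nat) with (1 * (a 2%nat * 1) + b 2%nat * 1 - a 2%nat)%C by ring.
    rewrite E1; ring. }
  rewrite B2 in *.
  split; [reflexivity | split; [reflexivity|]].
  match type of E2 with ?l = _ =>
    replace (b 3%nat) with (l + 2 * (a 2%nat * a 2%nat) - a 3%nat)%C by ring end.
  rewrite E2; ring.
Qed.

(** * Coefficients of the subordinate functions and the inequality *)

Lemma near0_pos_reals (P : C -> Prop) :
  near0 P -> exists r, 0 < r /\ forall x : R, 0 < x < r -> P (RtoC x).
Proof.
  intros [r [Hr HP]]; exists r; split; [assumption|].
  intros x Hx; apply HP; rewrite Cmod_R, Rabs_pos_eq; lra.
Qed.

(** Compare jets in [p * (1 - 2 t w + w^2) = 1]. *)
Lemma Phi_comp_coefficients (t : R) (p w : C -> C) (p0 p1 p2 w1 w2 : C) :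
  jet p 0 p0 p1 p2 -> jet w 0 0 w1 w2 ->
  near0 (fun z => p z = Phi t (w z)) ->
  p0 = 1%C /\ p1 = (2 * t * w1)%C /\
  p2 = (2 * t * w2 + (4 * (t * t) - 1) * (w1 * w1))%C.
Proof.
  intros Jp Jw Hp.
  pose proof (jet_plus _ _ _ _ _ _ _ _ _
    (jet_plus _ _ _ _ _ _ _ _ _ (jet_const 1 0)
       (jet_mult _ _ _ _ _ _ _ _ _ (jet_const (- (2 * t))%C 0) Jw))
    (jet_mult _ _ _ _ _ _ _ _ _ Jw Jw)) as Jd.
  pose proof (jet_mult _ _ _ _ _ _ _ _ _ Jp Jd) as J.
  assert (Hd : near0 (fun h => 1 + - (2 * t) * w (0 + h) + w (0 + h) * w (0 + h) <> 0)%C).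
  { apply (jet_neq0 _ _ _ _ _ Jd).
    intros H; apply (RtoC_neq0 1); [lra|]; rewrite <- H; ring. }
  destruct (jet_unique _ _ _ _ _ _ _ _ _ J (jet_const 1 0)) as (E0 & E1 & E2).
  { destruct (near0_pos_reals _ (near0_and _ _ Hp Hd)) as [r [Hr H]].
    exists r; split; [assumption|]; intros x Hx.
    destruct (H x Hx) as [H1 H2].
    replace (0 + x)%C with (RtoC x) in * by ring.
    rewrite H1; unfold Phi.
    replace (RtoC 1 - RtoC (2 * t) * w x + w x * w x)%C
      with (1 + - (2 * t) * w x + w x * w x)%C by (rewrite RtoC_mult; ring).
    field; assumption. }
  assert (P0 : p0 = 1%C) by (rewrite <- E0; ring).
  rewrite P0 in *.
  assert (P1 : p1 = (2 * t * w1)%C).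
  { match type of E1 with ?l = _ =>
      replace p1 with (l + 2 * t * w1)%C by ring end.
    rewrite E1; ring. }
  rewrite P1 in *.
  split; [reflexivity | split; [reflexivity|]].
  match type of E2 with ?l = _ =>
    replace p2 with (l + (2 * t * w2 + (4 * (t * t) - 1) * (w1 * w1)))%C by ring end.
  rewrite E2; ring.
Qed.

(** With [F z = z W z], clearing denominators turns the definition of [p] into
    [p F' W = (1 - lambda) F'^2 + lambda (F' + z F'') W], which involves only
    functions with a jet at 0. *)
Lemma convex_combination_coefficients
    (lambda : R) (A : nat -> C) (F p : C -> C) (p1 p2 : C) :
  sums_to A 1 F -> A 0%nat = 0%C -> A 1%nat = 1%C ->
  (forall z, in_disc z -> z <> RtoC 0 -> p z = convex_combination lambda F z) ->
  jet p 0 1 p1 p2 ->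
  p1 = ((1 + lambda) * A 2%nat)%C /\
  p2 = (2 * (1 + 2 * lambda) * A 3%nat - (1 + 3 * lambda) * (A 2%nat * A 2%nat))%C.
Proof.
  intros HF A0 A1 Hp Jp.
  pose proof (sums_to_C_derive _ _ _ HF) as HF1.
  pose proof (sums_to_C_derive _ _ _ HF1) as HF2.
  pose proof (sums_to_jet _ _ _ Rlt_0_1 (sums_to_div_shift _ _ _ HF)) as JW.
  pose proof (sums_to_jet _ _ _ Rlt_0_1 HF1) as J1.
  pose proof (sums_to_jet _ _ _ Rlt_0_1 HF2) as J2.
  unfold deriv_coef in J1, J2; simpl in JW, J1, J2.
  rewrite A0, A1 in JW.
  rewrite A1 in J1.
  pose proof (jet_mult _ _ _ _ _ _ _ _ _ (jet_mult _ _ _ _ _ _ _ _ _ Jp J1) JW) as JL.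
  pose proof (jet_plus _ _ _ _ _ _ _ _ _
    (jet_mult _ _ _ _ _ _ _ _ _ (jet_const (1 - lambda)%C 0)
       (jet_mult _ _ _ _ _ _ _ _ _ J1 J1))
    (jet_mult _ _ _ _ _ _ _ _ _ (jet_const lambda 0)
       (jet_mult _ _ _ _ _ _ _ _ _
          (jet_plus _ _ _ _ _ _ _ _ _ J1
             (jet_mult _ _ _ _ _ _ _ _ _ (jet_id 0) J2)) JW))) as JR.
  assert (one : RtoC 1 <> 0%C) by (apply RtoC_neq0; lra).
  destruct (jet_unique _ _ _ _ _ _ _ _ _ JL JR) as (_ & E1 & E2).
  { assert (HW : near0 (fun h => div_shift F 0 1 (0 + h) <> 0)%C)
      by (apply (jet_neq0 _ _ _ _ _ JW one)).
    assert (HD : near0 (fun h => C_derive F (0 + h) <> 0)%C).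
    { apply (jet_neq0 _ _ _ _ _ J1); replace (1 * 1)%C with (RtoC 1) by ring; exact one. }
    destruct (near0_pos_reals _ (near0_and _ _ HW HD)) as [r [Hr H]].
    exists (Rmin r 1); split; [apply Rmin_pos; lra|]; intros x Hx.
    pose proof (Rmin_l r 1); pose proof (Rmin_r r 1).
    destruct (H x) as [HxW HxD]; [lra|].
    replace (0 + x)%C with (RtoC x) in * by ring.
    assert (Hx0 : RtoC x <> 0%C) by (apply RtoC_neq0; lra).
    assert (Hin : in_disc x) by (unfold in_disc; rewrite Cmod_R, Rabs_pos_eq; lra).
    rewrite Hp by assumption; unfold convex_combination.
    assert (EF : F x = (x * div_shift F 0 1 x)%C).
    { pose proof (div_shift_eq F A x (HF x Hin)) as E; rewrite A0, A1 in E.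
      rewrite E at 1; ring. }
    rewrite EF, RtoC_minus; field; repeat split; assumption. }
  assert (P1 : p1 = ((1 + lambda) * A 2%nat)%C).
  { match type of E1 with ?l = ?m =>
      replace p1 with (l - m + (1 + lambda) * A 2%nat)%C by (rewrite ?RtoC_plus, ?RtoC_mult; ring) end.
    rewrite E1; ring. }
  rewrite P1 in *; split; [reflexivity|].
  match type of E2 with ?l = ?m =>
    replace p2 with (l - m + (2 * (1 + 2 * lambda) * A 3%nat
       - (1 + 3 * lambda) * (A 2%nat * A 2%nat)))%C
      by (rewrite ?RtoC_plus, ?RtoC_mult; ring) end.
  rewrite E2; ring.
Qed.

Lemma subordination_coefficients (lambda t : R) (A : nat -> C) (F : C -> C) :
  sums_to A 1 F -> A 0%nat = 0%C -> A 1%nat = 1%C ->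
  subordination_condition lambda t F ->
  exists w1 w2 : C, Cmod w2 <= 1 /\
    ((1 + lambda) * A 2%nat)%C = (2 * t * w1)%C /\
    (2 * (1 + 2 * lambda) * A 3%nat - (1 + 3 * lambda) * (A 2%nat * A 2%nat))%C
      = (2 * t * w2 + (4 * (t * t) - 1) * (w1 * w1))%C.
Proof.
  intros HF A0 A1 (p & Hp & Hpan & _ & w & Hwan & Hw0 & Hw).
  assert (H0 : in_disc 0) by (unfold in_disc; rewrite Cmod_0; lra).
  destruct (analytic_has_jet _ _ Hpan H0) as (p0 & p1 & p2 & Jp).
  destruct (analytic_has_jet _ _ Hwan H0) as (w0 & w1 & w2 & Jw).
  pose proof (jet_value _ _ _ _ _ Jw) as Ew0; rewrite Hw0 in Ew0; subst w0.
  exists w1, w2.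
  destruct (Phi_comp_coefficients t p w p0 p1 p2 w1 w2 Jp Jw) as (P0 & P1 & P2).
  { exists 1; split; [lra|]; intros z Hz; apply Hw, Hz. }
  subst p0.
  destruct (convex_combination_coefficients lambda A F p p1 p2 HF A0 A1 Hp Jp) as [Q1 Q2].
  split; [|split; congruence].
  apply (second_coefficient_bound w 0 w1 w2); auto.
  intros z Hz; now apply Hw.
Qed.

(** [|x + y| + |x - y| = 2 max(|x|, |y|)] for real [x], [y]. *)
Lemma Cmod_combination_le (x y : R) (u v : C) :
  Cmod u <= 1 -> Cmod v <= 1 ->
  Cmod (RtoC (x + y) * u + RtoC (x - y) * v)%C <= 2 * Rmax (Rabs x) (Rabs y).
Proof.
  intros Hu Hv.
  apply Rle_trans with (1 := Cmod_triangle _ _).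
  rewrite !Cmod_mult, !Cmod_R.
  pose proof (Cmod_ge_0 u); pose proof (Cmod_ge_0 v).
  pose proof (Rabs_pos (x + y)); pose proof (Rabs_pos (x - y)).
  apply Rle_trans with (Rabs (x + y) + Rabs (x - y)); [nra|].
  unfold Rmax, Rabs; destruct (Rle_dec _ _); repeat destruct (Rcase_abs _); lra.
Qed.

(** [S2], [S3] stand for [Psi 2 alpha], [Psi 3 alpha]; the four equations are the
    first- and second-order ones for [F] and for [G]. *)
Lemma fekete_szego_of_coefficient_equations
    (lambda t mu S2 S3 : R) (a2 a3 w1 w2 v1 v2 : C) :
  0 < t -> 0 <= lambda -> 0 < S3 ->
  Cmod w2 <= 1 -> Cmod v2 <= 1 ->
  ((1 + lambda) * (S2 * a2))%C = (2 * t * w1)%C ->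
  ((1 + lambda) * (S2 * - a2))%C = (2 * t * v1)%C ->
  (2 * (1 + 2 * lambda) * (S3 * a3) - (1 + 3 * lambda) * ((S2 * a2) * (S2 * a2)))%C
    = (2 * t * w2 + (4 * (t * t) - 1) * (w1 * w1))%C ->
  (2 * (1 + 2 * lambda) * (S3 * (2 * (a2 * a2) - a3))
     - (1 + 3 * lambda) * ((S2 * - a2) * (S2 * - a2)))%C
    = (2 * t * v2 + (4 * (t * t) - 1) * (v1 * v1))%C ->
  let K := (1 + 2 * lambda) * S3 in
  let D := (2 * K - (lambda ^ 2 + 5 * lambda + 2) * S2 ^ 2) * (4 * t ^ 2)
           + (1 + lambda) ^ 2 * S2 ^ 2 in
  (Rabs (mu - 1) <= Rabs D / (4 * t ^ 2) / (2 * K) ->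
     Cmod (a3 - RtoC mu * (a2 * a2))%C <= t / K) /\
  (Rabs D / (4 * t ^ 2) / (2 * K) <= Rabs (mu - 1) -> D <> 0 ->
     Cmod (a3 - RtoC mu * (a2 * a2))%C <= 8 * Rabs (1 - mu) * t ^ 3 / Rabs D).
Proof.
  intros Ht Hl HS3 Hw2 Hv2 E1 F1 E2 F2 K D.
  assert (HK : 0 < K) by (unfold K; apply Rmult_lt_0_compat; lra).
  assert (Ht2 : 0 < 4 * t ^ 2) by (assert (0 < t ^ 2) by (apply pow_lt; lra); lra).
  assert (HtC : RtoC t <> 0%C) by (apply RtoC_neq0; lra).
  assert (HKC : RtoC K <> 0%C) by (apply RtoC_neq0; lra).
  assert (H2C : RtoC 2 <> 0%C) by (apply RtoC_neq0; lra).
  assert (W1 : w1 = ((1 + lambda) * (S2 * a2) / (2 * t))%C)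
    by (rewrite E1; field; repeat split; assumption).
  assert (V1 : v1 = (- w1)%C).
  { replace v1 with ((2 * t * v1) / (2 * t))%C by (field; repeat split; assumption).
    rewrite <- F1, W1; field; repeat split; assumption. }
  (* Sum of the second-order equations, with [w1^2] eliminated. *)
  assert (Hsum : (RtoC D * (a2 * a2))%C = (4 * (t * t * t) * (w2 + v2))%C).
  { assert (HW : (4 * (t * t) * (w1 * w1))%C = ((1 + lambda) * (1 + lambda) * (S2 * S2) * (a2 * a2))%C).
    { rewrite W1; field; repeat split; assumption. }
    assert (Hadd : (2 * K * (a2 * a2) * 2 - 2 * (1 + 3 * lambda) * (S2 * S2 * (a2 * a2)))%C
       = (2 * t * (w2 + v2) + 2 * ((4 * (t * t) - 1) * (w1 * w1)))%C).
    { transitivity (2 * t * w2 + (4 * (t * t) - 1) * (w1 * w1)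
        + (2 * t * v2 + (4 * (t * t) - 1) * (v1 * v1)))%C; [|rewrite V1; ring].
      rewrite <- E2, <- F2; unfold K; rewrite RtoC_mult, RtoC_plus, RtoC_mult; ring. }
    transitivity (2 * (t * t) * (2 * K * (a2 * a2) * 2 - 2 * (1 + 3 * lambda) * (S2 * S2 * (a2 * a2)))
      - (4 * (t * t) - 1) * ((1 + lambda) * (1 + lambda) * (S2 * S2) * (a2 * a2)))%C.
    - unfold D.
      repeat rewrite ?RtoC_plus, ?RtoC_minus, ?RtoC_mult, ?RtoC_pow; ring.
    - rewrite Hadd, <- HW; ring. }
  (* Difference of the second-order equations; the terms in [w1^2] cancel. *)
  assert (Hdiff : (a3 - a2 * a2)%C = (t / (2 * K) * (w2 - v2))%C).
  { assert (Hsub : (4 * K * (a3 - a2 * a2))%C = (2 * t * (w2 - v2))%C).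
    { transitivity (2 * t * w2 + (4 * (t * t) - 1) * (w1 * w1)
        - (2 * t * v2 + (4 * (t * t) - 1) * (v1 * v1)))%C; [|rewrite V1; ring].
      rewrite <- E2, <- F2; unfold K; rewrite RtoC_mult, RtoC_plus, RtoC_mult; ring. }
    replace (a3 - a2 * a2)%C with ((4 * K * (a3 - a2 * a2)) / (4 * K))%C.
    - rewrite Hsub; field; repeat split; assumption.
    - field; assumption. }
  assert (Hmain : D <> 0 -> Cmod (a3 - RtoC mu * (a2 * a2))%C
     <= 2 * Rmax (Rabs (4 * t ^ 3 * (1 - mu) / D)) (Rabs (t / (2 * K)))).
  { intros HD.
    assert (HDC : RtoC D <> 0%C) by (apply RtoC_neq0; assumption).
    assert (Ha2 : (a2 * a2)%C = (4 * (t * t * t) * (w2 + v2) / D)%C)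
      by (rewrite <- Hsum; field; assumption).
    replace (a3 - RtoC mu * (a2 * a2))%C
      with ((a3 - a2 * a2) + (1 - mu) * (a2 * a2))%C by ring.
    rewrite Hdiff, Ha2.
    eapply Rle_trans; [right | apply (Cmod_combination_le _ _ w2 v2 Hw2 Hv2)].
    f_equal.
    unfold Rdiv; repeat rewrite ?RtoC_plus, ?RtoC_minus, ?RtoC_mult, ?RtoC_pow.
    rewrite !RtoC_inv by lra. rewrite !RtoC_mult.
    field; repeat split; assumption. }
  assert (HtK : Rabs (t / (2 * K)) = t / (2 * K)).
  { apply Rabs_pos_eq; left; apply Rdiv_lt_0_compat; lra. }
  assert (Hx : D <> 0 -> Rabs (4 * t ^ 3 * (1 - mu) / D) = 4 * t ^ 3 * Rabs (mu - 1) / Rabs D).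
  { intros HD.
    unfold Rdiv; rewrite !Rabs_mult, Rabs_inv, (Rabs_minus_sym 1 mu).
    rewrite (Rabs_pos_eq 4), (Rabs_pos_eq (t ^ 3)) by (try apply pow_le; lra); ring. }
  split.
  - intros HM.
    destruct (Req_dec D 0) as [HD|HD].
    + rewrite HD, Rabs_R0 in HM.
      assert (Hmu : mu = 1).
      { replace (0 / (4 * t ^ 2) / (2 * K)) with 0 in HM by (field; lra).
        destruct (Req_dec (mu - 1) 0) as [|Hne]; [lra|].
        apply Rabs_pos_lt in Hne; lra. }
      rewrite Hmu, Cmult_1_l, Hdiff.
      rewrite <- RtoC_mult, <- RtoC_div by lra.
      rewrite Cmod_mult, Cmod_R, HtK.
      pose proof (Cmod_triangle w2 (- v2)) as Htri; rewrite Cmod_opp in Htri.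
      apply Rle_trans with (t / (2 * K) * 2); [|right; field; lra].
      apply Rmult_le_compat_l; [rewrite <- HtK; apply Rabs_pos|].
      unfold Cminus; lra.
    + apply Rle_trans with (1 := Hmain HD).
      rewrite Hx, HtK by assumption.
      rewrite Rmax_right; [right; field; lra|].
      apply Rabs_pos_lt in HD.
      apply Rle_trans with (4 * t ^ 3 * (Rabs D / (4 * t ^ 2) / (2 * K)) / Rabs D).
      * apply Rmult_le_compat_r; [left; now apply Rinv_0_lt_compat|].
        apply Rmult_le_compat_l; [|assumption].
        assert (0 < t ^ 3) by (apply pow_lt; lra); lra.
      * right; field; lra.
  - intros HM HD.
    apply Rle_trans with (1 := Hmain HD).
    rewrite Hx, HtK by assumption.
    apply Rabs_pos_lt in HD.
    rewrite Rmax_left.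
    + rewrite (Rabs_minus_sym 1 mu); right; field; lra.
    + apply Rle_trans with (4 * t ^ 3 * (Rabs D / (4 * t ^ 2) / (2 * K)) / Rabs D).
      * right; field; lra.
      * apply Rmult_le_compat_r; [left; now apply Rinv_0_lt_compat|].
        apply Rmult_le_compat_l; [|assumption].
        assert (0 < t ^ 3) by (apply pow_lt; lra); lra.
Qed.

Theorem theorem3p1 (lambda alpha t : R) (f : C -> C) (a : nat -> C) (mu : R)
  (hlambda : 0 <= lambda <= 1) (halpha : 0 <= alpha < 1) (ht : 0 < t < 1)
  (hfa : normalized_series a f)
  (hf : class_R_Sigma lambda alpha t f) :
  let M :=
    Rabs ((1 + lambda) ^ 2 * Psi 2 alpha ^ 2 / (4 * t ^ 2)
          + 2 * (1 + 2 * lambda) * Psi 3 alpha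
          - (lambda ^ 2 + 5 * lambda + 2) * Psi 2 alpha ^ 2)
    / (2 * (1 + 2 * lambda) * Psi 3 alpha) in
  let D :=
    (2 * (1 + 2 * lambda) * Psi 3 alpha
     - (lambda ^ 2 + 5 * lambda + 2) * Psi 2 alpha ^ 2) * (4 * t ^ 2)
    + (1 + lambda) ^ 2 * Psi 2 alpha ^ 2 in
  (Rabs (mu - 1) <= M ->
     Cmod (a 3%nat - RtoC mu * (a 2%nat * a 2%nat))%C
       <= t / ((1 + 2 * lambda) * Psi 3 alpha)) /\
  (M <= Rabs (mu - 1) -> D <> 0 ->
     Cmod (a 3%nat - RtoC mu * (a 2%nat * a 2%nat))%C
       <= 8 * Rabs (1 - mu) * t ^ 3 / Rabs D).
Proof.
  intros M D.
  destruct hfa as (a0 & a1 & Ha).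
  destruct hf as ((_ & (_ & Hinj) & _) & g & F & G & (_ & rho & Hrho & Hg) & HF & HG & SF & SG).
  assert (Hb : exists b, power_series_on_disc b g)
    by (destruct HG as (_ & b & _ & Hb & _); now exists b).
  destruct Hb as [b Hb].
  assert (H0 : in_disc 0) by (unfold in_disc; rewrite Cmod_0; lra).
  assert (Hf0 : f 0%C = 0%C)
    by (rewrite (jet_value _ _ _ _ _ (sums_to_jet _ _ _ Rlt_0_1 Ha)); exact a0).
  (* [f (g 0) = 0 = f 0], and [f] is injective on the disc. *)
  assert (Hg0 : g 0%C = 0%C).
  { destruct (Hg 0%C) as [Hin Hfg]; [now rewrite Cmod_0|].
    apply Hinj; [assumption | assumption | now rewrite Hf0]. }
  destruct (inverse_coefficients a b f g rho a0 a1 Ha Hb Hg0 Hrho Hg) as (b1 & b2 & b3).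
  destruct (hadamard_s_fun_coefficients alpha a f F halpha Ha HF) as (A & HA & A0 & A1 & A2 & A3).
  destruct (hadamard_s_fun_coefficients alpha b g G halpha Hb HG) as (B & HB & B0 & B1 & B2 & B3).
  rewrite a1 in A1; rewrite b1 in B1; rewrite b2 in B2; rewrite b3 in B3.
  destruct (subordination_coefficients lambda t A F HA A0 A1 SF) as (w1 & w2 & Hw2 & W1 & W2).
  destruct (subordination_coefficients lambda t B G HB B0 B1 SG) as (v1 & v2 & Hv2 & V1 & V2).
  rewrite A2, A3 in *; rewrite B2, B3 in *.
  assert (HS3 : 0 < Psi 3 alpha) by (rewrite Psi_3; nra).
  pose proof (fekete_szego_of_coefficient_equations lambda t mu _ _ _ _ _ _ _ _
    ltac:(lra) ltac:(lra) HS3 Hw2 Hv2 W1 V1 W2 V2) as Hmain.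
  cbv zeta in Hmain.
  rewrite <- !(Rmult_assoc 2 (1 + 2 * lambda) (Psi 3 alpha)) in Hmain; fold D in Hmain.
  assert (Ht2 : 0 < 4 * t ^ 2) by (assert (0 < t ^ 2) by (apply pow_lt; lra); lra).
  replace M with (Rabs D / (4 * t ^ 2) / (2 * (1 + 2 * lambda) * Psi 3 alpha)); [exact Hmain|].
  unfold M; f_equal.
  rewrite <- (Rabs_pos_eq (4 * t ^ 2)) at 1 by lra.
  rewrite <- Rabs_div by lra; f_equal.
  unfold D; field; lra.
Qed.
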